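(* Let $k$ be a field, $n\le m$, $R=k[x_{ij}\mid 1\le i\le n,\ 1\le j\le m]$, $M=(x_{ij})$ the $n\times m$ matrix of variables, and $<$ any term order on $R$. Let $\Delta$ be an $(n-1)$-dimensional pure simplicial complex on $[m]$ such that $\Delta^\vee$ admits an ordering of its facets for which it is a free sequence of $\operatorname{po}(E_\bullet^<)$. Then the Alexander dual $(\operatorname{rain}_<(J_\Delta))^\vee$ is the polarization of an Artinian monomial ideal.
   Context: For an $n$-subset $\mathbf a\subseteq[m]$, $[\mathbf a]$ is the maximal minor of $M$ on the columns $\mathbf a$. $\operatorname{rain}_<(J_\Delta)$ is the monomial ideal generated by the lead monomials $\operatorname{in}_<([\mathbf a])$, $\mathbf a$ a facet of $\Delta$. $\Delta^\vee$ is the pure simplicial complex whose facets are exactly the $n$-subsets of $[m]$ that are not facets of $\Delta$. Sparse Eagon–Northcott complex $E^<_\bullet$: the minimal multigraded free resolution of $R/\operatorname{in}_<I_n(M)$ ($I_n(M)$ the ideal of maximal minors) obtained by homogenizing the Eagon–Northcott complex of $M$ with respect to $<$ using a new variable $t$ and then setting $t=0$, with basis inherited from the standard basis of the Eagon–Northcott complex. Its basis elements have pairwise distinct multidegrees; in homological degree $\ell>0$ these are the degree $n+\ell-1$ monomials $\prod_{i=1}^n\prod_{b\in\mathbf b_i}x_{ib}$ ($\mathbf b_i\subseteq[m]$ nonempty) such that $x_{1c_1}\cdots x_{nc_n}$ is a minimal generator of $\operatorname{in}_<I_n(M)$ for all $c_j\in\mathbf b_j$. $\operatorname{po}(E^<_\bullet)$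 is the poset of all basis elements generated transitively by $f\le e$ when $e$ is in homological degree $i$, $f$ in degree $i-1$, and $f$ occurs with nonzero coefficient in $d(e)$. It is the face poset of a regular CW complex, also denoted $\operatorname{po}(E^<_\bullet)$; its vertices (homological degree $1$) correspond bijectively to the $n$-subsets $\mathbf a$ of $[m]$, with label $\operatorname{in}_<([\mathbf a])$, and facets of $\Delta^\vee$ are viewed as vertices in this way. A vertex of a CW complex $\mathcal P$ is free if it is contained in a unique facet (maximal face). A free sequence is a sequence of vertices $v_1,\dots,v_s$ such that each $v_i$ is a free vertex of the subcomplex of $\mathcal P$ induced by deleting $v_1,\dots,v_{i-1}$. Alexander dual: for a (squarefree) monomial ideal $I$, $I^\vee$ is the ideal generated by all monomials having a nontrivial common divisor with every generator of $I$. Polarization: let $I\subseteq S=k[x_1,\dots,x_n]$ be an Artinian monomial ideal with $x_i^{m_i}$ a minimal generator for each $i$, and $\tilde S=k[x_{ij}\mid1\le i\le n,1\le j\le m_i]$. An ideal $\tilde I\subseteq\tilde S$ is a polarization of $I$ if the sequence of variable differences $\sigma=\{x_{i1}-x_{ij}\mid1\le i\le n,\ 2\le j\le m_i\}$ is regular on $\tilde S/\tilde I$ and $\tilde I\otimes\tilde S/\sigma\cong I$ (identifying $\tilde S/\sigma$ with $S$ via $x_{ij}\mapsto x_i$). Here the ambient ring of $(\operatorname{rain}_<(J_\Delta))^\vee$ is taken to be the polynomial ring in those variables $x_{ij}$ that divide some generator of $\operatorname{rain}_<(J_\Delta)$; the $i$-th block consists of such variables in row $i$ (relabelled $x_{i1},\dots,x_{im_i}$).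 *)

(* Defs.v *)
From HB Require Import structures.
From mathcomp Require Import all_boot all_order all_algebra.
From mathcomp.multinomials Require Export mpoly.

Set Implicit Arguments.
Unset Strict Implicit.
Unset Printing Implicit Defensive.

Import GRing.Theory.
Local Open Scope ring_scope.

(* Monomials and polynomials in variables indexed by a finite type T, through
   the enumeration of T. *)
Notation monT T := (multinom #|{: T}|).
Notation polyT k T := {mpoly k[#|{: T}|]}.

Definition var (k : fieldType) (T : finType) (t : T) : polyT k T :=
  'X_(enum_rank t).

(* The k-algebra morphism sending the variable of t to f t. *)
Definition subst_vars (k : fieldType) (T : finType) (N : nat)
    (f : T -> {mpoly k[N]}) (p : polyT k T) : {mpoly k[N]} :=
  mmap (@mpolyC N k) (fun r => f (enum_val r)) p.

Definition term_order (N : nat) (le : rel 'X_{1..N}) : Prop :=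
  [/\ reflexive le, antisymmetric le, transitive le & total le] /\
  [/\ forall u, le 0%MM u & forall u v w, le u v -> le (u + w)%MM (v + w)%MM].

Definition tmax (N : nat) (le : rel 'X_{1..N}) (u v : 'X_{1..N}) :=
  if le u v then v else u.

(* For a term order 0 is the least monomial, hence a neutral default value. *)
Definition lead_mon (k : fieldType) (N : nat) (le : rel 'X_{1..N})
    (p : {mpoly k[N]}) : 'X_{1..N} :=
  \big[tmax le/0%MM]_(u <- msupp p) u.

Definition is_ideal (k : fieldType) (N : nat) (J : {mpoly k[N]} -> Prop) :=
  [/\ J 0, forall p q, J p -> J q -> J (p + q) & forall p q, J q -> J (p * q)].

Definition ideal_gen (k : fieldType) (N : nat) (G : {mpoly k[N]} -> Prop)
    (p : {mpoly k[N]}) : Prop :=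
  exists s : seq ({mpoly k[N]} * {mpoly k[N]}),
    (forall c, c \in s -> G c.2) /\ p = \sum_(c <- s) c.1 * c.2.

Definition ideal_mul (k : fieldType) (N : nat) (G J : {mpoly k[N]} -> Prop) :=
  ideal_gen (fun q => exists a b, [/\ G a, J b & q = a * b]).

Definition mon_ideal (k : fieldType) (N : nat) (A : 'X_{1..N} -> Prop) :
    {mpoly k[N]} -> Prop :=
  ideal_gen (fun p => exists2 u, A u & p = 'X_[u]).

Definition monomial_ideal (k : fieldType) (N : nat) (J : {mpoly k[N]} -> Prop) :=
  exists A, forall p, J p <-> mon_ideal A p.

Definition min_gen (k : fieldType) (N : nat) (J : {mpoly k[N]} -> Prop)
    (u : 'X_{1..N}) : Prop :=
  J 'X_[u] /\ forall v, J 'X_[v] -> (v <= u)%MM -> v = u.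

(* The quotient by J is an Artinian ring: descending chains of ideals
   containing J are stationary. *)
Definition artinian_ideal (k : fieldType) (N : nat) (J : {mpoly k[N]} -> Prop) :=
  forall C : nat -> {mpoly k[N]} -> Prop,
    (forall l, is_ideal (C l)) ->
    (forall l p, J p -> C l p) ->
    (forall l p, C l.+1 p -> C l p) ->
    exists l0, forall l p, (l0 <= l)%N -> C l p <-> C l0 p.

Definition alexander_dual (k : fieldType) (N : nat) (J : {mpoly k[N]} -> Prop) :
    {mpoly k[N]} -> Prop :=
  mon_ideal (fun v => forall u, min_gen J u ->
    exists w : 'X_{1..N}, [/\ w != 0%MM, (w <= u)%MM & (w <= v)%MM]).

Definition regular_on_quotient (k : fieldType) (N : nat)
    (J : {mpoly k[N]} -> Prop) (s : seq {mpoly k[N]}) : Prop :=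
  (forall l p, (l < size s)%N ->
     ideal_gen (fun q => J q \/ q \in take l s) (s`_l * p) ->
     ideal_gen (fun q => J q \/ q \in take l s) p) /\
  ~ ideal_gen (fun q => J q \/ q \in s) 1.

(* Variables x_ij with i < n and j < d i. *)
Notation blocks n d := {i : 'I_n & 'I_(d i)}.

Definition first_in_block (n : nat) (d : 'I_n -> nat) (t : blocks n d) :
    blocks n d :=
  Tagged (fun i => 'I_(d i))
    (Ordinal (leq_ltn_trans (leq0n (tagged t)) (ltn_ord (tagged t)))).

Definition var_differences (k : fieldType) (n : nat) (d : 'I_n -> nat) :
    seq (polyT k (blocks n d)) :=
  [seq var k (first_in_block t) - var k t
     | t <- enum {: blocks n d} & (0 < nat_of_ord (tagged t))%N].

Definition collapse (k : fieldType) (n : nat) (d : 'I_n -> nat) :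
    polyT k (blocks n d) -> {mpoly k[n]} :=
  subst_vars (fun t : blocks n d => 'X_(tag t)).

(* The last two clauses say that collapse, which identifies the quotient by
   the variable differences sigma with k[x_1, ..., x_n], induces a bijection
   from Jt / sigma Jt, i.e. Jt tensored with that quotient, onto J. *)
Definition polarization (k : fieldType) (n : nat) (d : 'I_n -> nat)
    (J : {mpoly k[n]} -> Prop) (Jt : polyT k (blocks n d) -> Prop) : Prop :=
  [/\ monomial_ideal J, artinian_ideal J
    & forall i, min_gen J (U_(i) *+ d i)%MM] /\
  [/\ is_ideal Jt,
      regular_on_quotient Jt (var_differences k d),
      forall q, J q <-> exists2 p, Jt p & collapse p = q
    & forall p, Jt p -> collapse p = 0 ->
        ideal_mul (fun a => a \in var_differences k d) Jt p].

Definition simplicial_complex (T : finType) (D : {set {set T}}) : Prop :=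
  forall s t : {set T}, s \in D -> t \subset s -> t \in D.

Definition facets (T : finType) (D : {set {set T}}) : {set {set T}} :=
  [set a | maxset (fun s => s \in D) a].

Definition pure_complex (T : finType) (dim : nat) (D : {set {set T}}) : Prop :=
  [/\ simplicial_complex D, D != set0
    & forall a, a \in facets D -> #|a| = dim.+1].

Definition dual_complex (T : finType) (n : nat) (D : {set {set T}}) :
    {set {set T}} :=
  [set s : {set T} | [exists a : {set T},
     [&& #|a| == n, a \notin facets D & s \subset a]]].

Notation entries n m := ('I_n * 'I_m)%type.

(* The columns of a are taken in increasing order; meaningful for #|a| = n. *)
Definition minor (k : fieldType) (n m : nat) (a : {set 'I_m}) :
    polyT k (entries n m) :=
  \det (\matrix_(i < n, j < n)
          oapp (fun c : 'I_m => var k (i, c)) 0 (onth (enum a) j)).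

Definition rain_gens (k : fieldType) (n m : nat) (le : rel (monT (entries n m)))
    (D : {set {set 'I_m}}) : seq (monT (entries n m)) :=
  [seq lead_mon le (minor k n a) | a <- enum (facets D)].

Definition rain (k : fieldType) (n m : nat) (le : rel (monT (entries n m)))
    (D : {set {set 'I_m}}) : polyT k (entries n m) -> Prop :=
  mon_ideal (fun u => u \in rain_gens k le D).

Definition used_cols (k : fieldType) (n m : nat) (le : rel (monT (entries n m)))
    (D : {set {set 'I_m}}) (i : 'I_n) : {set 'I_m} :=
  [set c | has (fun u : monT (entries n m) => (0 < u (enum_rank (i, c)))%N)
             (rain_gens k le D)].

Definition used_card (k : fieldType) (n m : nat) (le : rel (monT (entries n m)))
    (D : {set {set 'I_m}}) (i : 'I_n) : nat :=
  #|used_cols k le D i|.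

(* Inclusion of the polynomial ring in the used variables; the j-th variable of
   block i is the j-th used variable of row i. *)
Definition used_incl (k : fieldType) (n m : nat) (le : rel (monT (entries n m)))
    (D : {set {set 'I_m}}) :
    polyT k (blocks n (used_card k le D)) -> polyT k (entries n m) :=
  subst_vars (fun t : blocks n (used_card k le D) =>
    var k (tag t, enum_val (tagged t))).

(* The generators of rain only involve used variables, so its contraction is
   the ideal with the same generators in the smaller ring. *)
Definition rain_dual (k : fieldType) (n m : nat) (le : rel (monT (entries n m)))
    (D : {set {set 'I_m}}) : polyT k (blocks n (used_card k le D)) -> Prop :=
  alexander_dual (fun p => rain le D (used_incl p)).

(* Basis of the Eagon-Northcott complex of the generic n x m matrix. None is
   the basis element 1 of R in degree 0; in degree l > 0 the module is
   D_(l-1)(R^n)^* tensored with the (n+l-1)-st exterior power of R^m, with basis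
   the pairs (A, alpha) where #|A| = n + l - 1 and alpha has degree l - 1. The
   bound m.+1 on the degree of alpha is automatic from #|A| <= m. *)
Notation en_basis n m :=
  (option {x : {set 'I_m} * 'X_{1..n < m.+1} | #|x.1| == (n + mdeg x.2)%N}).

Definition en_degree (n m : nat) (e : en_basis n m) : nat :=
  if e is Some x then (mdeg (val x).2).+1 else 0%N.

(* Coefficient of f in d(e): the maximal minors in degree 1, and above
     d(A, alpha) = \sum_(i : alpha_i > 0) \sum_(j in A)
                     (-1)^#|{a in A | a < j}| x_ij (A \ j, alpha - e_i). *)
Definition en_coef (k : fieldType) (n m : nat) (e f : en_basis n m) :
    polyT k (entries n m) :=
  match e, f with
  | Some x, Some y =>
      let: (A, alpha) := val x in
      let: (B, beta) := val y in
      \sum_(i < n) \sum_(j in A | (B == A :\ j)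
                        && ((alpha : 'X_{1..n}) == (beta + U_(i))%MM))
         (-1) ^+ #|[set a in A | (a < j)%N]| * var k (i, j)
  | Some x, None => if en_degree e == 1%N then minor k n (val x).1 else 0
  | None, _ => 0
  end.

(* Homogenizing with respect to the term order gives e the largest of the
   degrees of the terms of d(e), the degree of u * f being the product of u and
   the degree of f; each term is multiplied by the power of t that makes up for
   the difference. *)
Fixpoint en_multidegree_at (k : fieldType) (n m : nat)
    (le : rel (monT (entries n m))) (l : nat) (e : en_basis n m) :
    monT (entries n m) :=
  if l is l'.+1 then
    \big[tmax le/0%MM]_(f : en_basis n m | en_degree f == l')
      \big[tmax le/0%MM]_(u <- msupp (en_coef k e f))
         (u + en_multidegree_at k le l' f)%MM
  else 0%MM.

Definition en_multidegree (k : fieldType) (n m : nat)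
    (le : rel (monT (entries n m))) (e : en_basis n m) : monT (entries n m) :=
  en_multidegree_at k le (en_degree e) e.

(* Setting t = 0 keeps exactly the terms of top degree. *)
Definition sparse_en_coef (k : fieldType) (n m : nat)
    (le : rel (monT (entries n m))) (e f : en_basis n m) :
    polyT k (entries n m) :=
  \sum_(u <- msupp (en_coef k e f)
          | (u + en_multidegree k le f)%MM == en_multidegree k le e)
     (en_coef k e f)@_u *: 'X_[u].

Definition po_le (k : fieldType) (n m : nat) (le : rel (monT (entries n m))) :
    rel (en_basis n m) :=
  fun f e => connect (fun x y => (en_degree x == (en_degree y).+1)
                                 && (sparse_en_coef k le x y != 0)) e f.

Definition vertex (n m : nat) (a : {set 'I_m}) : en_basis n m :=
  insub (a, bm0).

(* X is the set of faces of a subcomplex of the complex with face poset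
   (T, face_le); the empty face may belong to X. *)
Definition maximal_face (T : finType) (face_le : rel T) (X : {set T}) (F : T) :=
  (F \in X) && [forall G in X, face_le F G ==> (G == F)].

Definition free_vertex (T : finType) (face_le : rel T) (is_vertex : pred T)
    (X : {set T}) (v : T) : bool :=
  [&& v \in X, is_vertex v
    & #|[set F | maximal_face face_le X F && face_le v F]| == 1%N].

Fixpoint free_sequence_in (T : finType) (face_le : rel T) (is_vertex : pred T)
    (X : {set T}) (s : seq T) : bool :=
  if s is v :: s' then
    free_vertex face_le is_vertex X v &&
    free_sequence_in face_le is_vertex [set F in X | ~~ face_le v F] s'
  else true.

Definition free_sequence_po (k : fieldType) (n m : nat)
    (le : rel (monT (entries n m))) (s : seq (en_basis n m)) : bool :=
  free_sequence_in (po_le k le) (fun e => en_degree e == 1%N) setT s.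

(* Main.v *)
From HB Require Import structures.
Require Import Defs.
From mathcomp Require Import all_boot all_order all_algebra.
From mathcomp Require Import fingroup perm zify.
From Stdlib Require Import Classical FunctionalExtensionality PropExtensionality.

Set Implicit Arguments.
Unset Strict Implicit.
Unset Printing Implicit Defensive.

Import GRing.Theory.

(* A monomial in the entries of the matrix is called optimal when it is maximal
   for the term order among the monomials with the same row and column degrees.
   Divisors of optimal monomials are optimal, the leading monomials of the minors
   are the optimal matchings, and the multidegrees of the sparse complex are the
   optimal monomials using each of its columns once; so f <= e in the poset forces
   the multidegree of f to divide that of e, and the vertices of a cell e are the
   matchings dividing its multidegree.

   Let V be a set of vertices. The dual ideal of V is the intersection of the
   primes P_a generated by the variables of a, for a in V. Modulo P_a the ring is
   a polynomial ring A in the differences of variables, so the quotient by the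
   dual ideal embeds in A^V and has rank |V| over A; it is generated over A by the
   monomials outside the collapsed ideal J(V). If there are at most |V| of these,
   they form a basis, and freeness over A gives regularity of the differences.

   The bound |V| on the number of standard monomials is proved by deleting free
   vertices. For V the set of all vertices, J(V) contains all monomials of degree
   m - n + 1 and there are binom(m, n) monomials of smaller degree. If a is a free
   vertex with facet F, the variables of F outside a give a product z that meets
   every vertex of V other than a, because the first syzygies of V are linear,
   whereas no product of the same row degrees meets all vertices of F; hence the
   collapse of z is a standard monomial of V but not of V minus a. *)

(** * Ideals and substitutions *)

Lemma addmCA N : left_commutative (@mnm_add N).
Proof. by move=> u v w; rewrite !addmA [(u + v)%MM]addmC. Qed.

Section Ideals.

Local Open Scope ring_scope.

Variables (k : fieldType) (N : nat).
Implicit Types (G J : {mpoly k[N]} -> Prop) (p q : {mpoly k[N]}).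

Lemma ideal_gen_sub G J p :
  is_ideal J -> (forall q, G q -> J q) -> ideal_gen G p -> J p.
Proof.
case=> J0 JD JM GJ [s [hs ->]]; elim: s hs => [|c s IH] hs.
  by rewrite big_nil.
rewrite big_cons; apply: JD; first by apply/JM/GJ/hs; rewrite mem_head.
by apply: IH => d ds; apply: hs; rewrite inE ds orbT.
Qed.

Lemma ideal_gen_ideal G : is_ideal (ideal_gen G).
Proof.
split=> [|p q [s [hs ->]] [t [ht ->]]|p q [s [hs ->]]].
- by exists [::]; rewrite big_nil.
- exists (s ++ t); rewrite big_cat; split=> // c.
  by rewrite mem_cat => /orP[/hs|/ht].
- exists [seq (p * c.1, c.2) | c <- s]; split=> [c /mapP[d ds ->]|].
    exact: (hs _ ds).
  by rewrite big_map mulr_sumr; apply: eq_bigr => c _; rewrite mulrA.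
Qed.

Lemma ideal_gen_incl G p : G p -> ideal_gen G p.
Proof.
move=> Gp; exists [:: (1, p)]; rewrite big_seq1 mul1r; split=> // c.
by rewrite inE => /eqP ->.
Qed.

Lemma ideal_sum J (I : Type) (s : seq I) (P : pred I) (F : I -> {mpoly k[N]}) :
  is_ideal J -> (forall i, P i -> J (F i)) -> J (\sum_(i <- s | P i) F i).
Proof. by case=> J0 JD _ JF; apply: (big_ind J). Qed.

Lemma ideal_sub J p q : is_ideal J -> J p -> J q -> J (p - q).
Proof. by case=> _ JD JM Jp Jq; rewrite -mulN1r; apply: JD => //; apply: JM. Qed.

Lemma mon_idealX (A : 'X_{1..N} -> Prop) u v :
  A u -> (u <= v)%MM -> mon_ideal A ('X_[v] : {mpoly k[N]}).
Proof.
move=> Au uv; rewrite -(submK uv) mpolyXD.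
have [_ _ JM] := ideal_gen_ideal (fun p => exists2 u, A u & p = 'X_[u]).
by apply: JM; apply: ideal_gen_incl; exists u.
Qed.

Lemma mon_ideal_msupp (A : 'X_{1..N} -> Prop) p v :
  mon_ideal A p -> v \in msupp p -> exists2 u, A u & (u <= v)%MM.
Proof.
case=> s [hs ->]; elim: s hs => [|c s IH] hs; first by rewrite big_nil msupp0.
rewrite big_cons => /msuppD_le; rewrite mem_cat => /orP[|]; last first.
  by apply: IH => d ds; apply: hs; rewrite inE ds orbT.
have [u Au ->] := hs c (mem_head _ _).
move=> /msuppM_le; rewrite msuppX => /allpairsP[[w x] /= [_]].
by rewrite inE => /eqP -> ->; exists u => //; apply: lem_addl.
Qed.

Lemma mon_ideal_X (A : 'X_{1..N} -> Prop) v :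
  mon_ideal A ('X_[v] : {mpoly k[N]}) -> exists2 u, A u & (u <= v)%MM.
Proof. by move/mon_ideal_msupp; apply; rewrite msuppX mem_head. Qed.

Lemma eq_mon_ideal (A B : 'X_{1..N} -> Prop) p :
  (forall u, A u <-> B u) -> mon_ideal A p <-> mon_ideal B p.
Proof.
move=> AB; split; apply: ideal_gen_sub; try exact: ideal_gen_ideal;
  by move=> q [u /AB Au ->]; apply: ideal_gen_incl; exists u.
Qed.

End Ideals.

Section Substitution.

Local Open Scope ring_scope.

Variables (k : fieldType).

Lemma mpoly_alg_ind N (P : {mpoly k[N]} -> Prop) :
  (forall c, P c%:MP) -> (forall i, P 'X_i) ->
  (forall p q, P p -> P q -> P (p + q)) ->
  (forall p q, P p -> P q -> P (p * q)) -> forall p, P p.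
Proof.
move=> PC PX PD PM p; rewrite [p]mpolyE.
apply: (big_ind P) => [||m _]; [by rewrite -mpolyC0; apply: (PC)|exact: PD|].
rewrite -mul_mpolyC; apply: (PM) => //; rewrite mpolyXE_id.
apply: (big_ind P) => [||i _]; [by rewrite -mpolyC1; apply: (PC)|exact: PM|].
elim: (m i) => [|e IH]; first by rewrite expr0 -mpolyC1; apply: PC.
by rewrite exprS; apply: PM.
Qed.

Definition msubst N M (h : 'I_N -> {mpoly k[M]}) : {mpoly k[N]} -> {mpoly k[M]} :=
  mmap (@mpolyC M k) h.

HB.instance Definition _ N M (h : 'I_N -> {mpoly k[M]}) :=
  GRing.RMorphism.copy (msubst h) (mmap (@mpolyC M k) h).

Lemma msubstC N M (h : 'I_N -> {mpoly k[M]}) c : msubst h c%:MP = c%:MP.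
Proof. exact: mmapC. Qed.

Lemma msubstX N M (h : 'I_N -> {mpoly k[M]}) i : msubst h 'X_i = h i.
Proof. by rewrite /msubst mmapX mmap1U. Qed.

Lemma msubst_comp N M Q (g : 'I_N -> {mpoly k[M]}) (h : 'I_M -> {mpoly k[Q]}) p :
  msubst h (msubst g p) = msubst (fun i => msubst h (g i)) p.
Proof.
elim/mpoly_alg_ind: p => [c|i|p q IHp IHq|p q IHp IHq].
- by rewrite !msubstC.
- by rewrite !msubstX.
- by rewrite !rmorphD /= IHp IHq.
- by rewrite !rmorphM /= IHp IHq.
Qed.

Lemma eq_msubst N M (g h : 'I_N -> {mpoly k[M]}) p :
  g =1 h -> msubst g p = msubst h p.
Proof.
move=> gh; elim/mpoly_alg_ind: p => [c|i|p q IHp IHq|p q IHp IHq].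
- by rewrite !msubstC.
- by rewrite !msubstX.
- by rewrite !rmorphD /= IHp IHq.
- by rewrite !rmorphM /= IHp IHq.
Qed.

Lemma msubst_id N (p : {mpoly k[N]}) : msubst (fun i => 'X_i) p = p.
Proof.
elim/mpoly_alg_ind: p => [c|i|p q IHp IHq|p q IHp IHq].
- by rewrite !msubstC.
- by rewrite !msubstX.
- by rewrite !rmorphD /= IHp IHq.
- by rewrite !rmorphM /= IHp IHq.
Qed.

Definition mnm_push N M (f : 'I_N -> 'I_M) (w : 'X_{1..N}) : 'X_{1..M} :=
  (\sum_r U_(f r) *+ w r)%MM.

Lemma mnm_pushE N M (f : 'I_N -> 'I_M) (w : 'X_{1..N}) i :
  mnm_push f w i = (\sum_(r | f r == i) w r)%N.
Proof.
rewrite /mnm_push mnm_sumE (bigID (fun r => f r == i)) /= addnC big1.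
  by apply: eq_bigr => r /eqP <-; rewrite mulmnE mnm1E eqxx mul1n.
by move=> r /negbTE fr; rewrite mulmnE mnm1E fr.
Qed.

Lemma mnm_pushD N M (f : 'I_N -> 'I_M) (v w : 'X_{1..N}) :
  mnm_push f (v + w)%MM = (mnm_push f v + mnm_push f w)%MM.
Proof.
apply/mnmP => i; rewrite mnmDE !mnm_pushE -big_split /=.
by apply: eq_bigr => r _; rewrite mnmDE.
Qed.

Lemma mnm_push1 N M (f : 'I_N -> 'I_M) r :
  mnm_push f U_(r)%MM = U_(f r)%MM.
Proof.
apply/mnmP => i; rewrite mnm_pushE mnm1E.
case: eqP => [<-|/eqP fr].
  rewrite (bigD1 r) //= mnm1E eqxx big1 // => s /andP[_ /negbTE sr].
  by rewrite mnm1E eq_sym sr.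
rewrite big1 // => s fs; rewrite mnm1E; case: eqP => // rs.
by rewrite rs fs in fr.
Qed.

Lemma mnm_push0 N M (f : 'I_N -> 'I_M) : mnm_push f 0%MM = 0%MM.
Proof. by apply/mnmP => i; rewrite mnm_pushE big1 ?mnm0E // => r; rewrite mnm0E. Qed.

Lemma mnm_push_comp N M Q (f : 'I_N -> 'I_M) (g : 'I_M -> 'I_Q) w :
  mnm_push g (mnm_push f w) = mnm_push (g \o f) w.
Proof.
apply/mnmP => i; rewrite !mnm_pushE.
rewrite [RHS](partition_big f (fun s => g s == i)) //=.
apply: eq_bigr => s /eqP gs; rewrite mnm_pushE; apply: eq_bigl => r.
by case: (f r =P s) => [->|_]; rewrite ?andbT ?andbF ?gs ?eqxx.
Qed.

Lemma mnm_push_id N (f : 'I_N -> 'I_N) w : f =1 id -> mnm_push f w = w.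
Proof.
move=> fE; apply/mnmP => i; rewrite mnm_pushE.
by rewrite (big_pred1 i) // => r /=; rewrite fE.
Qed.

Lemma mdeg_push N M (f : 'I_N -> 'I_M) (w : 'X_{1..N}) :
  mdeg (mnm_push f w) = mdeg w.
Proof.
rewrite /mnm_push mdeg_sum mdegE; apply: eq_bigr => i _.
by rewrite mdegMn mdeg1 mul1n.
Qed.

Lemma msubst_push N M (f : 'I_N -> 'I_M) (w : 'X_{1..N}) :
  msubst (fun r => 'X_(f r)) 'X_[w] = 'X_[mnm_push f w].
Proof. by rewrite /msubst mmapX /mmap1 /mnm_push mprodXnE. Qed.

End Substitution.

Arguments msubst : simpl never.
Arguments msubst {k N M} h p.

Lemma mnm_push_sum N M (f : 'I_N -> 'I_M) (I : Type) (s : seq I) (P : pred I)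
  (F : I -> 'X_{1..N}) :
  mnm_push f (\sum_(i <- s | P i) F i)%MM = (\sum_(i <- s | P i) mnm_push f (F i))%MM.
Proof. by apply: (big_morph _ (mnm_pushD f) (mnm_push0 f)). Qed.

Lemma mnm_push_le N M (f : 'I_N -> 'I_M) (v w : 'X_{1..N}) :
  (v <= w)%MM -> (mnm_push f v <= mnm_push f w)%MM.
Proof. by move/submK <-; rewrite mnm_pushD lem_addl. Qed.

Lemma mnm_push_ge N M (f : 'I_N -> 'I_M) (w : 'X_{1..N}) r : w r <= mnm_push f w (f r).
Proof. by rewrite mnm_pushE (bigD1 r) //= leq_addr. Qed.

Lemma lem_anti N (v w : 'X_{1..N}) : (v <= w)%MM -> (w <= v)%MM -> v = w.
Proof.
move=> /mnm_lepP vw /mnm_lepP wv; apply/mnmP => i.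
by apply/eqP; rewrite eqn_leq vw wv.
Qed.

Lemma lem_mdeg_eq N (v w : 'X_{1..N}) : (v <= w)%MM -> mdeg w <= mdeg v -> v = w.
Proof.
move=> vw; rewrite -{1}(submK vw) mdegD -{2}[mdeg v]add0n leq_add2r leqn0 mdeg_eq0.
by move/eqP => wv; rewrite -(submK vw) wv add0m.
Qed.

(** * Families of points and the differences of variables *)

Section Depolarize.

Local Open Scope ring_scope.

Variables (k : fieldType) (N n q : nat).
Variables (rowof : 'I_N -> 'I_n) (base : 'I_n -> 'I_N).
Hypothesis baseK : cancel base rowof.
Variable pt : 'I_q -> 'I_n -> 'I_N.
Hypothesis ptK : forall a, cancel (pt a) rowof.

Local Notation S := {mpoly k[N]}.

Definition hitting (w : 'X_{1..N}) := forall a, exists i, (0 < w (pt a i))%N.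

Definition hitting_ideal : S -> Prop := mon_ideal hitting.

Definition vdiff r : S := 'X_(base (rowof r)) - 'X_r.

Definition fold_rows : S -> {mpoly k[n]} := msubst (fun r => 'X_(rowof r)).

Definition unfold_rows : {mpoly k[n]} -> S := msubst (fun i => 'X_(base i)).

(* The retraction of S onto S / P_a, P_a generated by the variables of the
   point a, that fixes every difference of variables. *)
Definition at_point a : S -> S := msubst (fun r => 'X_r - 'X_(pt a (rowof r))).

HB.instance Definition _ := GRing.RMorphism.copy fold_rows
  (msubst (fun r => 'X_(rowof r) : {mpoly k[n]})).
HB.instance Definition _ := GRing.RMorphism.copy unfold_rows
  (msubst (fun i => 'X_(base i) : S)).
HB.instance Definition _ a := GRing.RMorphism.copy (at_point a)
  (msubst (fun r => 'X_r - 'X_(pt a (rowof r)) : S)).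

Lemma at_pointX a r : at_point a 'X_r = 'X_r - 'X_(pt a (rowof r)).
Proof. exact: msubstX. Qed.

Lemma at_point_vdiff a r : at_point a (vdiff r) = vdiff r.
Proof.
rewrite /vdiff rmorphB /= !at_pointX baseK.
by rewrite opprB addrA subrK.
Qed.

Lemma at_point_hitting a p : hitting_ideal p -> at_point a p = 0.
Proof.
move=> [s [hs ->]]; rewrite rmorph_sum big1_seq //= => c /hs [w hw ->].
rewrite rmorphM /=; have [i wi] := hw a.
have /submK <- : (U_(pt a i) <= w)%MM by rewrite lep1mP -lt0n.
by rewrite mpolyXD rmorphM /= at_pointX ptK subrr !mulr0.
Qed.

(** When [L] is duplicate-free and contains no base variable, the kernel of this map is
    [diff_ideal L], which is therefore prime. Regularity of the differences on the polynomial ring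
    itself rests on this. *)
Definition fold_some (L : seq 'I_N) : S -> S :=
  msubst (fun r => if r \in L then 'X_(base (rowof r)) else 'X_r).

HB.instance Definition _ L := GRing.RMorphism.copy (fold_some L)
  (msubst (fun r => if r \in L then 'X_(base (rowof r)) else 'X_r : S)).

(** There is one coefficient for each variable of [L], so that the coefficients can later be
    expanded in standard monomials. *)
Definition diff_ideal (L : seq 'I_N) (p : S) : Prop :=
  exists c : 'I_N -> S, p = \sum_(r <- L) vdiff r * c r.

Lemma diff_ideal_ideal L : is_ideal (diff_ideal L).
Proof.
split=> [|p p' [c ->] [c' ->]|p p' [c ->]].
- by exists (fun=> 0); rewrite big1 // => r _; rewrite mulr0.
- exists (fun r => c r + c' r); rewrite -big_split.
  by apply: eq_bigr => r _; rewrite mulrDr.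
- exists (fun r => p * c r); rewrite mulr_sumr.
  by apply: eq_bigr => r _; rewrite mulrCA.
Qed.

Lemma diff_ideal_vdiff (L : seq 'I_N) r :
  uniq L -> r \in L -> diff_ideal L (vdiff r).
Proof.
move=> uL rL; exists (fun s => (s == r)%:R).
rewrite (bigD1_seq r) //= eqxx mulr1 big1 ?addr0 // => s /negbTE ->.
by rewrite mulr0.
Qed.

Lemma fold_someP L p : uniq L -> diff_ideal L (p - fold_some L p).
Proof.
move=> uL; have DI := diff_ideal_ideal L; have [D0 DD DM] := DI.
elim/mpoly_alg_ind: p => [c|r|p p' IH IH'|p p' IH IH'].
- by rewrite /fold_some msubstC subrr.
- rewrite /fold_some msubstX; case: ifP => rL; last by rewrite subrr.
  rewrite -opprB -mulN1r; apply: (DM); exact: diff_ideal_vdiff.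
- by rewrite rmorphD /= opprD addrACA; apply: DD.
- rewrite rmorphM /=.
  have -> : p * p' - fold_some L p * fold_some L p' =
     p' * (p - fold_some L p) + fold_some L p * (p' - fold_some L p').
    by rewrite !mulrBr addrA [p' * p]mulrC [p' * _]mulrC subrK.
  by apply: DD; apply: (DM).
Qed.

Lemma fold_some_diff (L : seq 'I_N) p :
  (forall r, base (rowof r) \notin L) ->
  diff_ideal L p -> fold_some L p = 0.
Proof.
move=> bL [c ->]; rewrite rmorph_sum big1_seq //= => r rL.
rewrite rmorphM /= /vdiff rmorphB /= /fold_some !msubstX rL.
by rewrite (negbTE (bL r)) subrr mul0r.
Qed.

(** When [L] lists all non-base variables, [fold_some L] is [fold_rows] followed by
    [unfold_rows]. *)
Lemma fold_rows0_diff (L : seq 'I_N) p : uniq L ->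
  (forall r, (r \in L) = (r != base (rowof r))) ->
  fold_rows p = 0 -> diff_ideal L p.
Proof.
move=> uL hL fp; have := fold_someP p uL.
suff -> : fold_some L p = unfold_rows (fold_rows p).
  by rewrite fp rmorph0 subr0.
rewrite /unfold_rows msubst_comp; apply: eq_msubst => r.
by rewrite msubstX hL; case: eqP => //= <-.
Qed.

Lemma unfold_rowsK : cancel unfold_rows fold_rows.
Proof.
move=> p; rewrite /fold_rows msubst_comp -[RHS]msubst_id.
by apply: eq_msubst => i; rewrite msubstX baseK.
Qed.

Lemma vdiff_neq0 r : r != base (rowof r) -> vdiff r != 0.
Proof.
move=> rb; apply/eqP => /(congr1 (mcoeff U_(r))).
rewrite mcoeffB !mcoeffXU mcoeff0 eqxx eq_sym (negbTE rb) sub0r.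
by move/eqP; rewrite oppr_eq0 oner_eq0.
Qed.

(** * Freeness of the quotient over the ring of differences *)

Variable std : 'I_q -> 'X_{1..n}.
Hypothesis stdP : forall u,
  (forall w, mnm_push rowof w = u -> ~ hitting w) -> exists x, std x = u.
Hypothesis pt_inj : forall a b, a != b -> exists i, pt a i != pt b i.

(** [std] has to cover the standard exponents with as many indices as there are points; that it has
    no repetitions is not assumed. *)
Definition std_mon x : S := 'X_[mnm_push base (std x)].

(** The common fixed ring of the retractions stands in for the ring A of the differences. It
    contains the constants and every [vdiff r], and its elements pass through each [at_point a] as
    scalars. *)
Definition at_fixed (c : S) := forall a, at_point a c = c.

Definition std_span (p : S) : Prop :=
  exists c : 'I_q -> S, (forall x, at_fixed (c x)) /\
    hitting_ideal (p - \sum_x c x * std_mon x).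

Lemma std_spanD p p' : std_span p -> std_span p' -> std_span (p + p').
Proof.
move=> [c [fc Ic]] [c' [fc' Ic']]; exists (fun x => c x + c' x); split.
  by move=> x a; rewrite rmorphD /= fc fc'.
under eq_bigr do rewrite mulrDl.
rewrite big_split /= opprD addrACA.
by have [_ D _] := ideal_gen_ideal (fun p : S => exists2 u, hitting u & p = 'X_[u]);
   apply: D.
Qed.

Lemma std_spanM f p : at_fixed f -> std_span p -> std_span (f * p).
Proof.
move=> ff [c [fc Ic]]; exists (fun x => f * c x); split.
  by move=> x a; rewrite rmorphM /= ff fc.
under eq_bigr do rewrite -mulrA.
rewrite -mulr_sumr -mulrBr.
by have [_ _] := ideal_gen_ideal (fun p : S => exists2 u, hitting u & p = 'X_[u]);
   apply.
Qed.

Lemma std_span_hitting p : hitting_ideal p -> std_span p.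
Proof.
move=> Ip; exists (fun=> 0); split=> [x a|]; first by rewrite rmorph0.
by rewrite big1 ?subr0 // => x _; rewrite mul0r.
Qed.

Lemma at_fixedC c : at_fixed c%:MP.
Proof. by move=> a; rewrite /at_point msubstC. Qed.

(** Within a row, ['X_s] equals ['X_r] plus [vdiff r - vdiff s], and the correction multiplies
    ['X_[w]], a monomial of smaller degree with a fixed coefficient. *)
Lemma std_span_move d w r s :
  (forall v, (mdeg v < d)%N -> std_span 'X_[v]) -> (mdeg w < d)%N ->
  rowof r = rowof s -> std_span 'X_[(U_(r) + w)] -> std_span 'X_[(U_(s) + w)].
Proof.
move=> IH wd rs; rewrite !mpolyXD => Hr.
have -> : 'X_s = 'X_r + (vdiff r + (-1)%:MP * vdiff s) :> S.
  rewrite /vdiff rs mpolyCN mpolyC1 mulN1r opprB.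
  have aux (b x y : S) : y = x + ((b - x) + (y - b)).
    by rewrite addrC [b - x + _]addrC addrA !subrK.
  exact: aux.
rewrite mulrDl; apply: std_spanD => //; apply: std_spanM; last exact: IH.
by move=> a; rewrite rmorphD rmorphM /= !at_point_vdiff at_fixedC.
Qed.

(** The variables of [w] are moved to their base variables one at a time; [v] collects those already
    moved. *)
Lemma std_span_fold d w v :
  (forall v, (mdeg v < d)%N -> std_span 'X_[v]) -> (mdeg (w + v) <= d)%N ->
  std_span 'X_[(w + v)] <-> std_span 'X_[(mnm_push (base \o rowof) w + v)].
Proof.
move=> IH; move: {2}(mdeg w) (erefl (mdeg w)) => e.
elim: e w v => [|e IHe] w v ew.
  by move/eqP: ew; rewrite mdeg_eq0 => /eqP ->; rewrite mnm_push0.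
have [r wr] : exists r, (0 < w r)%N.
  apply/existsP/contraT => /existsPn w0.
  by move: ew; rewrite mdegE big1 // => r _; apply/eqP; rewrite -leqn0 leqNgt.
have wE : w = (U_(r) + (w - U_(r)))%MM.
  by rewrite addmC submK // lep1mP -lt0n.
move: (w - U_(r))%MM wE ew => {wr} w0 ->; rewrite mdegD mdeg1 => -[ew0].
rewrite mnm_pushD mnm_push1 /= -!addmA mdegD mdeg1 => dw.
have rr : rowof (base (rowof r)) = rowof r by rewrite baseK.
rewrite [(_ + (mnm_push _ w0 + v))%MM]addmCA -IHe //; last first.
  by rewrite addmCA mdegD mdeg1.
by rewrite [(w0 + (_ + _))%MM]addmCA; split; apply: (std_span_move IH).
Qed.

(** Once smaller degrees are spanned, being spanned depends only on the row degrees of [w]. Either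
    some monomial with these row degrees meets every point and lies in the ideal, or the row degrees
    form a standard exponent. *)
Lemma std_span_mon w : std_span 'X_[w].
Proof.
have [d dw] : {d | mdeg w < d}%N by exists (mdeg w).+1.
elim: d w dw => // d IH w dw.
have [//|nspan] := classic (std_span 'X_[w]).
have span_eq w' : mnm_push rowof w' = mnm_push rowof w ->
    std_span 'X_[w'] -> std_span 'X_[w].
  have := @std_span_fold d w 0 IH; have := @std_span_fold d w' 0 IH.
  rewrite !addm0 => H' H ww'.
  have dd : mdeg w' = mdeg w.
    by have := congr1 (@mdeg _) ww'; rewrite !mdeg_push.
  rewrite H // H' ?dd //.
  by rewrite -(mnm_push_comp rowof base w) -ww' (mnm_push_comp rowof base).
have [x xw] : exists x, std x = mnm_push rowof w.
  apply: stdP => w' ww' hw'; apply: nspan; apply: (span_eq w') => //.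
  by apply/std_span_hitting/ideal_gen_incl; exists w'.
apply: (span_eq (mnm_push base (std x))).
  by rewrite mnm_push_comp mnm_push_id.
exists (fun y => (y == x)%:R); split.
  by move=> y a; rewrite rmorph_nat.
rewrite (bigD1 x) //= eqxx mul1r big1 ?addr0 ?subrr.
  by have [] := ideal_gen_ideal (fun p : S => exists2 u, hitting u & p = 'X_[u]).
by move=> y /negbTE ->; rewrite mul0r.
Qed.

Lemma std_span_all p : std_span p.
Proof.
rewrite [p]mpolyE; apply: big_ind => [||m _].
- apply: std_span_hitting.
  by have [] := ideal_gen_ideal (fun p : S => exists2 u, hitting u & p = 'X_[u]).
- exact: std_spanD.
- by rewrite -mul_mpolyC; apply/std_spanM/std_span_mon/at_fixedC.
Qed.

(* The products sep a vanish at every point except a; expanding them in the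
   standard monomials gives M a right inverse up to a diagonal matrix. *)
Lemma std_free (c : 'I_q -> S) : (forall x, at_fixed (c x)) ->
  hitting_ideal (\sum_x c x * std_mon x) -> forall x, c x = 0.
Proof.
move=> fc Ic.
pose M := \matrix_(a < q, x < q) at_point a (std_mon x).
pose sep a := \prod_(b | b != a)
  (if [pick i | pt a i != pt b i] is Some i then 'X_(pt b i) else 0) : S.
have sepE a b : at_point b (sep a) != 0 <-> a = b.
  split=> [|<-].
    apply: contra_neq_eq => ab; rewrite /sep (bigD1 b) 1?eq_sym //= rmorphM /=.
    case: pickP => [i _|_]; last by rewrite rmorph0 mul0r.
    by rewrite at_pointX ptK subrr mul0r.
  rewrite /sep rmorph_prod /=; apply/prodf_neq0 => c' ca.
  case: pickP => [i abi|abF]; last first.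
    by have [i] := pt_inj ca; rewrite eq_sym abF.
  rewrite at_pointX ptK; apply/eqP => /(congr1 (mcoeff U_(pt c' i))).
  rewrite mcoeffB !mcoeffXU mcoeff0 eqxx (negbTE abi) subr0.
  by move/eqP; rewrite oner_eq0.
have [B BP] : exists B : 'M[S]_q, M *m B = \matrix_(a, b) at_point a (sep b).
  have /fin_all_exists [d dP] := fun b => std_span_all (sep b).
  exists (\matrix_(x, b) d b x); apply/matrixP => a b; rewrite !mxE.
  have [fd /(at_point_hitting a)] := dP b.
  rewrite rmorphB rmorph_sum /= => /subr0_eq ->.
  by apply: eq_bigr => x _; rewrite !mxE rmorphM /= fd mulrC.
have detM : \det M != 0.
  have : \det (M *m B) != 0.
    rewrite BP; have -> : \matrix_(a, b) at_point a (sep b)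
       = diag_mx (\row_a at_point a (sep a)).
      apply/matrixP => a b; rewrite !mxE; case: eqP => [->//|ab].
      rewrite mulr0n; apply/eqP/negPn/negP => /sepE /esym; exact: ab.
    rewrite det_diag; apply/prodf_neq0 => a _; rewrite mxE; exact/sepE.
  by rewrite det_mulmx mulf_eq0 negb_or => /andP[].
pose C : 'cV[S]_q := \col_x c x.
have MC : M *m C = 0.
  apply/matrixP => a j; rewrite !mxE.
  have := at_point_hitting a Ic; rewrite rmorph_sum => {2}<-.
  by apply: eq_bigr => x _; rewrite !mxE rmorphM /= fc mulrC.
have /(congr1 (mulmx (\adj M))) := MC.
rewrite mulmxA mul_adj_mx mulmx0 mul_scalar_mx => /matrixP C0 x.
by have := C0 x 0; rewrite !mxE => /eqP; rewrite mulf_eq0 (negbTE detM) => /eqP.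
Qed.

Lemma hitting_ideal_ideal : is_ideal hitting_ideal.
Proof. exact: ideal_gen_ideal. Qed.

(** * Regularity of the differences modulo the dual ideal *)

Variable L : seq 'I_N.
Hypothesis uL : uniq L.
Hypothesis memL : forall r, (r \in L) = (r != base (rowof r)).

Lemma hitting_diff_ideal (L' : seq 'I_N) p : uniq L' ->
  ideal_gen (fun x => hitting_ideal x \/ x \in map vdiff L') p <->
  exists2 u, hitting_ideal u & diff_ideal L' (p - u).
Proof.
move=> uL'; have HI := hitting_ideal_ideal; have [I0 ID IM] := HI.
have [D0 DD DM] := diff_ideal_ideal L'.
have [G0 GD GM] := ideal_gen_ideal
  (fun x => hitting_ideal x \/ x \in map vdiff L').
split=> [|[u Iu [c pE]]].
  apply: (ideal_gen_sub (J := fun x =>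
    exists2 u, hitting_ideal u & diff_ideal L' (x - u))) => [|x [Ix|/mapP[r rL ->]]].
  - split=> [|x y [u Iu Du] [v Iv Dv]|x y [u Iu Du]].
    + by exists 0; rewrite ?subr0.
    + by exists (u + v); [apply: ID|rewrite opprD addrACA; apply: DD].
    + by exists (x * u); [apply: IM|rewrite -mulrBr; apply: DM].
  - by exists x; rewrite ?subrr.
  - by exists 0; rewrite ?subr0 //; apply: diff_ideal_vdiff.
rewrite -(subrK u p) pE; apply: GD; last by apply: ideal_gen_incl; left.
rewrite big_seq; apply: ideal_sum => [|r rL]; first exact: ideal_gen_ideal.
by rewrite mulrC; apply/GM/ideal_gen_incl; right; apply: map_f.
Qed.

(** [fold_some L'] fixes [vdiff r], which is nonzero, and its values lie in a domain. *)
Lemma vdiff_regular (L' : seq 'I_N) r c :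
  uniq L' -> {subset L' <= L} -> r \in L -> r \notin L' ->
  diff_ideal L' (vdiff r * c) -> diff_ideal L' c.
Proof.
move=> uL' subL rL rL'.
have bL s : base (rowof s) \notin L'.
  by apply: contraT => /negbNE /subL; rewrite memL baseK eqxx.
move=> /(fold_some_diff bL); rewrite rmorphM /=.
have -> : fold_some L' (vdiff r) = vdiff r.
  by rewrite /vdiff rmorphB /= /fold_some !msubstX (negbTE (bL r)) (negbTE rL').
have vr : vdiff r != 0 by apply: vdiff_neq0; rewrite -memL.
move/eqP; rewrite mulf_eq0 (negbTE vr) => /eqP c0.
by rewrite -(subr0 c) -{1}c0; apply: fold_someP.
Qed.

(** Expanding every coefficient in the standard monomials leaves errors [e r] in the dual ideal.
    They are kept explicit because [hitting_diff_mul] needs them. *)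
Lemma diff_coords (L' : seq 'I_N) (u : S) : uniq L' -> {subset L' <= L} ->
  diff_ideal L' u -> exists c : 'I_q -> 'I_N -> S,
   (forall x r, at_fixed (c x r)) /\ exists e : 'I_N -> S,
     (forall r, hitting_ideal (e r)) /\
     u = \sum_(r <- L') vdiff r * (\sum_x c x r * std_mon x + e r).
Proof.
move=> uL' subL [c ->].
have /fin_all_exists [d dP] := fun r => std_span_all (c r).
exists (fun x r => d r x); split; first by move=> x r; case: (dP r).
exists (fun r => c r - \sum_x d r x * std_mon x); split.
  by move=> r; case: (dP r).
by apply: eq_bigr => r _; rewrite [X in _ = _ * X]addrC subrK.
Qed.

Lemma at_fixed_sum (L' : seq 'I_N) (c : 'I_N -> S) :
  (forall r, at_fixed (c r)) -> at_fixed (\sum_(r <- L') vdiff r * c r).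
Proof.
move=> fc a; rewrite rmorph_sum; apply: eq_bigr => r _.
by rewrite rmorphM /= at_point_vdiff fc.
Qed.

Lemma sum_vdiff_std (L' : seq 'I_N) (c : 'I_q -> 'I_N -> S) :
  \sum_(r <- L') vdiff r * (\sum_x c x r * std_mon x) =
  \sum_x (\sum_(r <- L') vdiff r * c x r) * std_mon x.
Proof.
under eq_bigr do rewrite mulr_sumr.
rewrite exchange_big; apply: eq_bigr => x _ /=; rewrite mulr_suml.
by apply: eq_bigr => r _; rewrite mulrA.
Qed.

(** By freeness an equation modulo the dual ideal can be read coordinate by coordinate, which
    reduces regularity on the quotient to [vdiff_regular]. *)
Lemma hitting_regular : (0 < q)%N ->
  regular_on_quotient hitting_ideal (map vdiff L).
Proof.
move=> q0; have HI := hitting_ideal_ideal; have [I0 ID IM] := HI.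
split=> [l p|]; last first.
  case/(hitting_diff_ideal _ uL) => u Iu.
  case/(diff_coords uL (fun _ => id)) => c [fc [e [Ie uE]]].
  (* Since there is a point, the monomial 1 does not meet all points, so it is standard. Its
     coordinate would write 1 as a combination of differences, and folding kills the latter. *)
  have [x x0] : exists x, std x = 0%MM.
    apply: stdP => w /(congr1 (@mdeg _)); rewrite mdeg_push mdeg0 => /eqP.
    rewrite mdeg_eq0 => /eqP -> /(_ (Ordinal q0)) [i]; by rewrite mnm0E.
  have x1 : std_mon x = 1 by rewrite /std_mon x0 mnm_push0 mpolyX0.
  have := @std_free (fun y => (y == x)%:R - \sum_(r <- L) vdiff r * c y r) _ _ x.
  rewrite eqxx => H.
  have /(congr1 (fold_some L)) : 1 - \sum_(r <- L) vdiff r * c x r = 0.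
    apply: H => [y a|]; first by rewrite rmorphB rmorph_nat /= at_fixed_sum.
    under eq_bigr do rewrite mulrBl.
    rewrite sumrB -sum_vdiff_std (bigD1 x) //= eqxx mul1r x1 big1 ?addr0; last first.
      by move=> y /negbTE ->; rewrite mul0r.
    have -> : 1 - \sum_(r <- L) vdiff r * (\sum_y c y r * std_mon y) =
       u + \sum_(r <- L) vdiff r * e r.
      have aux (a b : S) : 1 - u = a + b -> 1 - a = u + b.
        move=> H1; apply/eqP; rewrite subr_eq; apply/eqP.
        by rewrite -[LHS](subrK u) H1 -addrA addrC [b + u]addrC.
      apply: aux; rewrite uE; under eq_bigr do rewrite mulrDr.
      by rewrite big_split.
    by apply: ID => //; apply: ideal_sum => // r _; apply: IM.
  rewrite rmorphB /= rmorph1 fold_some_diff ?subr0 ?rmorph0.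
  - by move/eqP; rewrite oner_eq0.
  - by move=> r; rewrite memL baseK eqxx.
  - by exists (c x).
rewrite size_map => lL.
have r0 : 'I_N by case: {+}L lL.
set r := nth r0 L l; set L' := take l L.
have uL' : uniq L' by rewrite take_uniq.
have subL : {subset L' <= L} by move=> s /mem_take.
have rL : r \in L by rewrite mem_nth.
have rL' : r \notin L'.
  have : uniq (L' ++ drop l L) by rewrite cat_take_drop.
  rewrite (drop_nth r0 lL) cat_uniq => /and3P[_ /hasPn/(_ r) + _].
  by rewrite mem_head => /(_ isT).
rewrite -map_take -/L' (nth_map r0) // -/r => /(hitting_diff_ideal _ uL').
case=> u Iu /(diff_coords uL' subL) [c [fc [e [Ie uE]]]].
have [d [fd Id]] := std_span_all p.
apply/(hitting_diff_ideal _ uL'); eexists; first exact: Id.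
rewrite opprB addrC subrK; apply: ideal_sum; first exact: diff_ideal_ideal.
move=> x _; have [_ _ DM] := diff_ideal_ideal L'; rewrite mulrC; apply: DM.
apply: (vdiff_regular uL' subL rL rL'); exists (c x).
(* The coordinates of [vdiff r * p] and of its expression through the earlier differences agree by
   [std_free]. *)
apply/eqP; rewrite -subr_eq0; apply/eqP; move: x.
apply: std_free => [x a|].
  by rewrite rmorphB rmorphM /= at_point_vdiff fd at_fixed_sum.
under eq_bigr do rewrite mulrBl -mulrA.
rewrite sumrB -mulr_sumr -sum_vdiff_std.
set D := \sum_x d x * std_mon x in Id *.
have -> : vdiff r * D - \sum_(s <- L') vdiff s * (\sum_x c x s * std_mon x) =
   u + \sum_(s <- L') vdiff s * e s - vdiff r * (p - D).
  have aux (a b c' u' : S) : a - b = u' + c' - (b + c' + u' - a).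
    rewrite opprB addrCA; congr (_ + _).
    by rewrite -[b + _ + _]addrA opprD addrCA [c' + u']addrC subrr addr0.
  have {}uE : vdiff r * p - u = \sum_(s <- L') vdiff s *
      (\sum_x c x s * std_mon x) + \sum_(s <- L') vdiff s * e s.
    by rewrite uE -big_split; apply: eq_bigr => s _; rewrite mulrDr.
  by rewrite mulrBr -[vdiff r * p](subrK u) uE; apply: aux.
apply: ideal_sub => //; last exact: IM.
by apply: ID => //; apply: ideal_sum => // s _; apply: IM.
Qed.

(** This is the vanishing of Tor: an element of both ideals lies in their product. Freeness kills
    the standard part of its expansion in the differences, and only the errors, which lie in the
    dual ideal, remain as coefficients. *)
Lemma hitting_diff_mul p : hitting_ideal p -> fold_rows p = 0 ->
  ideal_mul (fun x => x \in map vdiff L) hitting_ideal p.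
Proof.
move=> Ip /(fold_rows0_diff uL memL) /(diff_coords uL (fun _ => id)).
case=> c [fc [e [Ie pE]]]; have HI := hitting_ideal_ideal; have [I0 ID IM] := HI.
have Z : forall x, \sum_(r <- L) vdiff r * c x r = 0.
  apply: std_free => [x|]; first exact: at_fixed_sum.
  rewrite -sum_vdiff_std.
  have -> : \sum_(r <- L) vdiff r * (\sum_x c x r * std_mon x) =
    p - \sum_(r <- L) vdiff r * e r.
    by rewrite pE -sumrB; apply: eq_bigr => r _; rewrite -mulrBr addrK.
  apply: ideal_sub => //.
  by apply: ideal_sum => // r _; apply: IM.
have -> : p = \sum_(r <- L) vdiff r * e r.
  rewrite pE; under eq_bigr do rewrite mulrDr.
  rewrite big_split /= sum_vdiff_std big1 ?add0r // => x _.
  by rewrite Z mul0r.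
rewrite big_seq; apply: ideal_sum => [|r rL]; first exact: ideal_gen_ideal.
apply: ideal_gen_incl.
by exists (vdiff r), (e r); split=> //; apply: map_f.
Qed.

End Depolarize.

(** * Artinian quotients *)

Section Artinian.

Local Open Scope ring_scope.

Variable k : fieldType.

Definition is_subspace N (V : 'rV[k]_N -> Prop) :=
  V 0 /\ forall c u v, V u -> V v -> V (c *: u + v).

(** A row space inside [V] is enlarged by vectors of [V] until it is all of [V]; [e] bounds the
    corank still available. *)
Lemma subspace_rowspace N (V : 'rV[k]_N -> Prop) : is_subspace V ->
  exists A : 'M_N, forall v, V v <-> (v <= A)%MS.
Proof.
case=> V0 VL; suff: forall e (A : 'M[k]_N), (N - \rank A <= e)%N ->
    (forall v : 'rV_N, (v <= A)%MS -> V v) ->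
    exists A : 'M_N, forall v, V v <-> (v <= A)%MS.
  move=> H; apply: (H N 0); first by rewrite leq_subr.
  by move=> v; rewrite submx0 => /eqP ->.
elim=> [|e IH] A rA VA.
  exists A => v; split=> [_|/VA //]; apply: submx_full.
  by rewrite /row_full eqn_leq rank_leq_col -subn_eq0 -leqn0.
have [AV|] := classic (forall v, V v -> (v <= A)%MS).
  by exists A => v; split=> [/AV|/VA].
move=> nall; have [v nv] := not_all_ex_not _ _ nall.
have [Vv vA] := imply_to_and _ _ nv.
apply: (IH (A + v)%MS) => [|w /sub_addsmxP[[a b] /= ->]].
  have : (A < A + v)%MS.
    rewrite ltmxE addsmxSl; apply/negP => AvA; apply: vA.
    exact: submx_trans (addsmxSr _ _) AvA.
  by move/rank_ltmx => ltr; lia.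
rewrite addrC; have -> : b *m v = b 0 0 *: v.
  by apply/rowP => j; rewrite !mxE big_ord1.
by apply: VL => //; apply: VA; apply: submxMl.
Qed.

(** Each strict descent lowers the rank, so the induction is on a bound for the rank. *)
Lemma subspace_chain N (V : nat -> 'rV[k]_N -> Prop) :
  (forall l, is_subspace (V l)) -> (forall l v, V l.+1 v -> V l v) ->
  exists l0, forall l v, (l0 <= l)%N -> V l v <-> V l0 v.
Proof.
move=> sV dV; have mono l l' v : (l <= l')%N -> V l' v -> V l v.
  move/subnK <-; elim: (l' - l)%N => // e IH; rewrite addSn => /dV; exact: IH.
suff: forall e l (A : 'M_N), (forall v, V l v <-> (v <= A)%MS) ->
    (\rank A <= e)%N -> exists l0, forall l v, (l0 <= l)%N -> V l v <-> V l0 v.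
  have [A VA] := subspace_rowspace (sV 0%N).
  by move/(_ N 0%N A VA); apply; apply: rank_leq_col.
elim=> [|e IH] l A VA rA.
  exists l => l' v ll'; split; first exact: mono.
  move/VA; have /eqP -> : A == 0 by rewrite -mxrank_eq0 -leqn0.
  by rewrite submx0 => /eqP ->; case: (sV l').
have [st|] := classic (forall l' v, (l <= l')%N -> V l v -> V l' v).
  by exists l => l' v ll'; split; [apply: mono|apply: st].
move=> nall; have [l' nl'] := not_all_ex_not _ _ nall.
have [v nv] := not_all_ex_not _ _ nl'.
have [ll' nv'] := imply_to_and _ _ nv; have [Vv nV'v] := imply_to_and _ _ nv'.
have [A' VA'] := subspace_rowspace (sV l'); apply: (IH l' A' VA').
rewrite -ltnS; apply: leq_trans rA; apply: rank_ltmx; rewrite ltmxE.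
apply/andP; split.
  by apply/rV_subP => w /VA' V'w; apply/VA/(mono _ _ _ ll').
by apply/negP => AA'; apply: nV'v; apply/VA'; apply: submx_trans AA'; apply/VA.
Qed.

(** All monomials of degree at least [D] lie in [J], so an ideal containing [J] is determined by its
    trace on the finite-dimensional space of polynomials of degree less than [D]. *)
Lemma artinian_powers n (J : {mpoly k[n]} -> Prop) (d : 'I_n -> nat) :
  (forall i, J 'X_[(U_(i) *+ d i)]) -> artinian_ideal J.
Proof.
move=> Jd C idC JC dC.
(* A monomial of this degree has some exponent at least [d i]; the successor keeps this true when
   there are no variables. *)
pose D := (\sum_i d i).+1.
have bigC l m : (D <= mdeg m)%N -> C l 'X_[m].
  move=> Dm; have [_ _ CM] := idC l.
  have [i di] : exists i, (d i <= m i)%N.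
    apply/existsP/contraT => /existsPn dm; move: Dm.
    rewrite mdegE ltnNge leq_sum // => i _; apply: ltnW.
    by rewrite ltnNge dm.
  have /submK <- : (U_(i) *+ d i <= m)%MM.
    apply/mnm_lepP => j; rewrite mulmnE mnm1E.
    by case: eqP => [<-|_]; rewrite ?mul1n ?mul0n.
  by rewrite mpolyXD; apply/CM/JC/Jd.
pose N := #|{: 'X_{1..n < D}}|.
pose e (j : 'I_N) : 'X_{1..n} := enum_val j.
pose vec (v : 'rV[k]_N) : {mpoly k[n]} := \sum_j v 0 j *: 'X_[e j].
pose cof (p : {mpoly k[n]}) : 'rV[k]_N := \row_j p@_(e j).
have vecL c u v : vec (c *: u + v) = c%:MP * vec u + vec v.
  rewrite /vec mulr_sumr -big_split; apply: eq_bigr => j _ /=.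
  by rewrite mul_mpolyC !mxE scalerDl scalerA.
have cofP l p : C l (p - vec (cof p)).
  have -> : p - vec (cof p) =
      \sum_(m <- msupp p | (D <= mdeg m)%N) p@_m *: 'X_[m].
    apply/mpolyP => m; rewrite mcoeffB /vec !(@raddf_sum _ _ (mcoeff m)) /=.
    have [mD|Dm] := ltnP (mdeg m) D.
      rewrite (bigD1 (enum_rank (BMultinom mD))) //= [X in _ = X]big1; last first.
        move=> u Du; rewrite mcoeffZ mcoeffX; case: eqP => [um|_]; last by rewrite mulr0.
        by rewrite um leqNgt mD in Du.
      rewrite big1 => [|j jm]; rewrite mcoeffZ mcoeffX.
        by rewrite mxE /e enum_rankK eqxx mulr1 addr0 subrr.
      case: eqP => [ejm|_]; last by rewrite mulr0.
      case/eqP: jm; apply: enum_val_inj; rewrite enum_rankK.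
      by apply: val_inj.
    rewrite [X in _ - X]big1 => [|j _]; last first.
      rewrite mcoeffZ mcoeffX; case: eqP => [ejm|_]; last by rewrite mulr0.
      by have := bmdeg (enum_val j); rewrite -/(e j) ejm ltnNge Dm.
    have [mp|/memN_msupp_eq0 pm] := boolP (m \in msupp p).
      rewrite big_mkcond (bigD1_seq m) ?msupp_uniq //= Dm subr0 mcoeffZ mcoeffX.
      rewrite eqxx mulr1.
      rewrite big1 ?addr0 // => u /negbTE um.
      by case: ifP => // _; rewrite mcoeffZ mcoeffX um mulr0.
    rewrite pm subr0 big1 // => u _; rewrite mcoeffZ mcoeffX.
    by case: eqP => [->|_]; rewrite ?mulr0 // pm mul0r.
  have [_ _ CM] := idC l; apply: ideal_sum => // m Dm.
  by rewrite -mul_mpolyC; apply/CM/bigC.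
have [||l0 st] := @subspace_chain N (fun l v => C l (vec v)).
- move=> l; have [C0 CD CM] := idC l; split.
    by rewrite /vec big1 // => j _; rewrite mxE scale0r.
  by move=> c u v Cu Cv; rewrite vecL; apply: CD => //; apply: CM.
- by move=> l v; apply: dC.
exists l0 => l p ll0; have [C0 CD CM] := idC l.
have [C0' CD' CM'] := idC l0.
rewrite -(subrK (vec (cof p)) p); split=> H.
  apply: CD' => //; apply/(st l) => //.
  by rewrite -[vec _](addKr (p - vec (cof p))) addrC; apply: ideal_sub.
apply: CD => //; apply/st => //.
by rewrite -[vec _](addKr (p - vec (cof p))) addrC; apply: ideal_sub.
Qed.

End Artinian.

(** * Monomials of maximal order among those with given margins *)

Section TermOrder.

Variables (N : nat) (le : rel 'X_{1..N}).
Hypothesis hle : term_order le.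

Lemma to_refl u : le u u. Proof. by case: hle => [[]]. Qed.

Lemma to_anti u v : le u v -> le v u -> u = v.
Proof. by case: hle => [[_ H _ _] _] uv vu; apply: H; rewrite uv. Qed.

Lemma to_trans v u w : le u v -> le v w -> le u w.
Proof. by case: hle => [[_ _ H _] _]; apply: H. Qed.

Lemma to_total u v : le u v || le v u.
Proof. by case: hle => [[_ _ _ H] _]. Qed.

Lemma to_ge0 u : le 0%MM u. Proof. by case: hle => [_ []]. Qed.

Lemma to_add u v w : le u v -> le (u + w)%MM (v + w)%MM.
Proof. by case: hle => [_ [_]]; apply. Qed.

Lemma to_addK u v w : le (u + w)%MM (v + w)%MM -> le u v.
Proof.
move=> uvw; have [//|vu] := orP (to_total u v).
by have /addIm -> := to_anti uvw (to_add w vu); apply: to_refl.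
Qed.

Lemma tmax_ge (I : eqType) (s : seq I) (P : pred I) (F : I -> 'X_{1..N}) i :
  i \in s -> P i -> le (F i) (\big[tmax le/0%MM]_(j <- s | P j) F j).
Proof.
elim: s => // j s IH; rewrite inE big_cons => /orP[/eqP <-|si] Pi.
  rewrite Pi /tmax; case: ifP => // _; exact: to_refl.
have := IH si Pi; set b := \big[_/_]_(_ <- _ | _) _ => Fb.
case: ifP => // _; rewrite /tmax; case: ifP => // jb.
by apply: to_trans Fb _; case/orP: (to_total (F j) b) => //; rewrite jb.
Qed.

(** The default value 0 does no harm: if it is the result, every listed monomial is at most 0 and
    hence equal to 0. *)
Lemma tmax_attained (I : eqType) (s : seq I) (P : pred I) (F : I -> 'X_{1..N}) i :
  i \in s -> P i -> exists j, [/\ j \in s, P j &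
    \big[tmax le/0%MM]_(j <- s | P j) F j = F j].
Proof.
suff: \big[tmax le/0%MM]_(j <- s | P j) F j = 0%MM \/
    exists j, [/\ j \in s, P j & \big[tmax le/0%MM]_(j <- s | P j) F j = F j].
  case=> // b0 si Pi; exists i; split=> //; apply: to_anti; last exact: tmax_ge.
  by rewrite b0; apply: to_ge0.
elim: s => [|j s IH]; first by left; rewrite big_nil.
rewrite big_cons; case Pj: (P j); last first.
  by case: IH => [|[l [ls Pl ->]]]; [left|right; exists l; rewrite inE ls orbT].
rewrite {1 3}/tmax; case: ifP => jb; last by right; exists j; rewrite mem_head.
by case: IH => [|[l [ls Pl ->]]]; [left|right; exists l; rewrite inE ls orbT].
Qed.

End TermOrder.

Section Margins.

Variables (n m : nat).
Local Notation mon := (monT (entries n m)).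

Definition entry (i : 'I_n) (j : 'I_m) : 'I_#|{: entries n m}| := enum_rank (i, j).

Definition rsum (T : mon) i := \sum_j T (entry i j).
Definition csum (T : mon) j := \sum_i T (entry i j).

Lemma entryP (T T' : mon) : (forall i j, T (entry i j) = T' (entry i j)) -> T = T'.
Proof.
move=> TT'; apply/mnmP => r; rewrite -(enum_valK r).
by case: (enum_val r) => i j; apply: TT'.
Qed.

Lemma entry_lep (T T' : mon) :
  (forall i j, T (entry i j) <= T' (entry i j)) -> (T <= T')%MM.
Proof.
move=> TT'; apply/mnm_lepP => r; rewrite -(enum_valK r).
by case: (enum_val r) => i j; apply: TT'.
Qed.

Lemma eq_entry i j i' j' : (entry i j == entry i' j') = (i == i') && (j == j').
Proof. by rewrite (inj_eq enum_rank_inj). Qed.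

Lemma rsumD (T T' : mon) i : rsum (T + T')%MM i = rsum T i + rsum T' i.
Proof. by rewrite /rsum -big_split; apply: eq_bigr => j _; rewrite mnmDE. Qed.

Lemma csumD (T T' : mon) j : csum (T + T')%MM j = csum T j + csum T' j.
Proof. by rewrite /csum -big_split; apply: eq_bigr => i _; rewrite mnmDE. Qed.

Lemma rsumU i j i' : rsum U_(entry i j)%MM i' = (i == i').
Proof.
rewrite /rsum (bigD1 j) //= mnm1E eq_entry eqxx andbT big1 ?addn0 //.
by move=> j' /negbTE jj'; rewrite mnm1E eq_entry [j == _]eq_sym jj' andbF.
Qed.

Lemma csumU i j j' : csum U_(entry i j)%MM j' = (j == j').
Proof.
rewrite /csum (bigD1 i) //= mnm1E eq_entry eqxx big1 ?addn0 //.
by move=> i' /negbTE ii'; rewrite mnm1E eq_entry [i == _]eq_sym ii'.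
Qed.

Lemma rsum0 i : rsum 0%MM i = 0.
Proof. by rewrite /rsum big1 // => j _; rewrite mnm0E. Qed.

Lemma csum0 j : csum 0%MM j = 0.
Proof. by rewrite /csum big1 // => i _; rewrite mnm0E. Qed.

Lemma rsumMn (T : mon) q i : rsum (T *+ q)%MM i = rsum T i * q.
Proof.
by rewrite /rsum big_distrl; apply: eq_bigr => j _; rewrite mulmnE.
Qed.

Lemma csumMn (T : mon) q j : csum (T *+ q)%MM j = csum T j * q.
Proof.
by rewrite /csum big_distrl; apply: eq_bigr => i _; rewrite mulmnE.
Qed.

Lemma mdeg_rsum (T : mon) : mdeg T = \sum_i rsum T i.
Proof.
rewrite mdegE pair_bigA (reindex (@enum_rank {: entries n m})) /=.
  by apply: eq_bigr => -[i j] _.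
exact/onW_bij/enum_rank_bij.
Qed.

Lemma entry_le_csum (T : mon) i j : T (entry i j) <= csum T j.
Proof. by rewrite /csum (bigD1 i) //= leq_addr. Qed.

(** Induction on the total: a variable is placed where both its row and its column still have
    positive demand. *)
Lemma margins_exist (r : 'I_n -> nat) (s : 'I_m -> nat) :
  \sum_i r i = \sum_j s j -> exists T : mon, rsum T =1 r /\ csum T =1 s.
Proof.
move: {2}(\sum_i r i) (erefl (\sum_i r i)) => d.
elim: d r s => [|d IH] r s rd rs.
  exists 0%MM; split=> [i|j]; rewrite ?rsum0 ?csum0; apply/esym/eqP.
    by move/eqP: rd; rewrite sum_nat_eq0 => /forallP/(_ i).
  by move/eqP: rd; rewrite rs sum_nat_eq0 => /forallP/(_ j).
have [i ri] : exists i, 0 < r i.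
  apply/existsP/contraT => /existsPn r0; move: rd.
  by rewrite big1 // => i _; apply/eqP; rewrite -leqn0 leqNgt.
have [j sj] : exists j, 0 < s j.
  apply/existsP/contraT => /existsPn s0; move: rd.
  by rewrite rs big1 // => j _; apply/eqP; rewrite -leqn0 leqNgt.
have dec (I : finType) (f : I -> nat) x : 0 < f x ->
    \sum_y f y = (\sum_y (f y - (x == y))).+1.
  move=> fx; rewrite (bigD1 x) //= [in RHS](bigD1 x) //= eqxx -addSn.
  congr (_ + _); first by lia.
  by apply: eq_bigr => y /negbTE; rewrite eq_sym => ->; rewrite subn0.
have [||T [Tr Ts]] := IH (fun i' => r i' - (i == i')) (fun j' => s j' - (j == j')).
- by move: rd; rewrite (dec _ _ i) // => -[].
- by move: rs; rewrite (dec _ _ i) // (dec _ s j) // => -[].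
exists (T + U_(entry i j))%MM; split=> [i'|j'].
  by rewrite rsumD rsumU Tr; case: eqP => [<-|_]; lia.
by rewrite csumD csumU Ts; case: eqP => [<-|_]; lia.
Qed.

Definition same_margins (T T' : mon) := rsum T =1 rsum T' /\ csum T =1 csum T'.

Definition mfun (g : 'I_n -> 'I_m) : mon := (\sum_i U_(entry i (g i)))%MM.

Lemma mfunE g i j : mfun g (entry i j) = (g i == j).
Proof.
rewrite mnm_sumE (bigD1 i) //= mnm1E eq_entry eqxx big1 ?addn0 //.
by move=> i' /negbTE ii'; rewrite mnm1E eq_entry ii'.
Qed.

Lemma rsum_mfun g i : rsum (mfun g) i = 1.
Proof.
rewrite /rsum (bigD1 (g i)) //= mfunE eqxx big1 ?addn0 // => j.
by rewrite mfunE eq_sym => /negbTE ->.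
Qed.

Lemma csum_mfun g j : csum (mfun g) j = #|[set i | g i == j]|.
Proof.
rewrite /csum -sum1dep_card [RHS]big_mkcond; apply: eq_bigr => i _.
by rewrite mfunE; case: eqP.
Qed.

Lemma csum_mfun_inj g j : injective g -> csum (mfun g) j = (j \in codom g).
Proof.
move=> gI; rewrite csum_mfun; case: (boolP (j \in codom g)) => [/codomP[i ->]|jg].
  rewrite (_ : [set _ | _] = [set i]) ?cards1 //; apply/setP => i'.
  by rewrite !inE (inj_eq gI).
apply/eqP; rewrite cards_eq0; apply/eqP/setP => i; rewrite !inE.
by apply/negbTE; apply: contra jg => /eqP <-; apply: codom_f.
Qed.

Variable (le : rel mon).
Hypothesis hle : term_order le.

Definition opt (T : mon) := forall T', same_margins T T' -> le T' T.

Lemma opt_unique T T' : opt T -> opt T' -> same_margins T T' -> T = T'.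
Proof.
move=> oT oT' TT'; apply: (to_anti hle); last exact: oT.
by apply: oT'; case: TT' => rr cc; split=> x.
Qed.

(** Replacing the factor [S] of [T] by a monomial with the same margins preserves the margins of
    [T], and the cofactor cancels in the comparison. *)
Lemma opt_sub S T : opt T -> (S <= T)%MM -> opt S.
Proof.
move=> oT ST S' [rr cc]; apply: (to_addK hle (w := (T - S)%MM)).
rewrite [X in le _ X]addmC submK //; apply: oT; rewrite -{1}(submK ST).
split=> x; first by rewrite !rsumD -rr addnC.
by rewrite !csumD -cc addnC.
Qed.

(** The margins determine the degree, so the maximum is taken over the finite type of monomials of
    bounded degree. *)
Lemma opt_exists T : exists2 T', same_margins T T' & opt T'.
Proof.
pose P (u : 'X_{1..#|{: entries n m}| < (mdeg T).+1}) :=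
  [forall i, rsum T i == rsum u i] && [forall j, csum T j == csum u j].
have PP u : P u <-> same_margins T u.
  split=> [/andP[/forallP rr /forallP cc]|[rr cc]].
    by split=> x; apply/eqP.
  by apply/andP; split; apply/forallP => x; rewrite ?rr ?cc.
have bd (u : mon) : same_margins T u -> mdeg u < (mdeg T).+1.
  by move=> [rr _]; rewrite !mdeg_rsum (eq_bigr _ (fun i _ => rr i)).
have TT : same_margins T T by [].
have PT : P (BMultinom (bd T TT)) by apply/PP.
have iT := mem_index_enum (BMultinom (bd T TT)).
have [u [_ /PP Pu eu]] := tmax_attained hle (@bmnm _ _) iT PT.
exists u => // T' [rr cc]; rewrite -eu.
have TT' : same_margins T T' by case: Pu => ru cu; split=> x; rewrite ?ru ?cu.
have PT' : P (BMultinom (bd T' TT')) by apply/PP.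
have := tmax_ge hle (@bmnm _ _) (mem_index_enum (BMultinom (bd T' TT'))) PT'.
exact.
Qed.

(* On a minimal nonempty subset of D stable under f the map f is a permutation;
   moving the columns of g along it turns a part of mfun g into a part of T with
   the same margins. *)
Lemma exchange T g (f : 'I_n -> 'I_n) (D : {set 'I_n}) :
  opt T -> opt (mfun g) -> injective g -> D != set0 ->
  (forall i, i \in D -> [/\ f i \in D, f i != i & 0 < T (entry (f i) (g i))]) ->
  False.
Proof.
move=> oT og gI D0 fD.
pose stable (C : {set 'I_n}) := [&& C != set0, C \subset D & f @: C \subset C].
have [|C /minsetP[/and3P[C0 CD fC] Cmin] _] := @minset_exists _ stable D.
  rewrite /stable D0 subxx; apply/subsetP => _ /imsetP[i iD ->].
  by case: (fD i iD).
have fCC : f @: C = C.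
  apply: Cmin => //; apply/and3P; split.
  - have /set0Pn[i iC] := C0; apply/set0Pn; exists (f i); exact: imset_f.
  - exact: subset_trans CD.
  - exact: imsetS.
have fI : {in C &, injective f} by apply/imset_injP; rewrite fCC.
pose old : mon := (\sum_(i in C) U_(entry i (g i)))%MM.
pose new : mon := (\sum_(i in C) U_(entry (f i) (g i)))%MM.
have oldE i j : old (entry i j) = (i \in C) && (g i == j).
  rewrite /old mnm_sumE; case: (boolP (i \in C)) => iC.
    rewrite (bigD1 i) //= mnm1E eq_entry eqxx big1 ?addn0 // => i' /andP[_ ii'].
    by rewrite mnm1E eq_entry (negbTE ii').
  rewrite big1 // => i' iC'; rewrite mnm1E eq_entry; case: eqP => // ii'.
  by rewrite ii' (negbTE iC) in iC'.
have newE i j : new (entry i j) = \sum_(i' in C) ((f i' == i) && (g i' == j)).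
  by rewrite /new mnm_sumE; apply: eq_bigr => i' _; rewrite mnm1E eq_entry.
have oo : opt old.
  apply: (opt_sub og); apply: entry_lep => i j; rewrite oldE mfunE.
  by case: (i \in C).
have on : opt new.
  apply: (opt_sub oT); apply: entry_lep => i j; rewrite newE.
  have [/existsP[i' /and3P[iC fi gi]]|] :=
      boolP [exists i', [&& i' \in C, f i' == i & g i' == j]].
    rewrite (bigD1 i') //= fi gi big1 ?addn0 => [|i'' /andP[iC' ii']].
      case: (fD i' (subsetP CD _ iC)) => _ _; by rewrite (eqP fi) (eqP gi).
    case: eqP => // fi'; case/eqP: ii'; apply: fI => //.
    by rewrite fi' (eqP fi).
  rewrite negb_exists => /forallP no; rewrite big1 // => i' iC.
  by move: (no i'); rewrite iC /= => /negbTE ->.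
have : old = new.
  apply: opt_unique => //; split=> [i|j].
    rewrite /rsum; under eq_bigr do rewrite oldE.
    under [RHS]eq_bigr do rewrite newE.
    rewrite exchange_big /=; under [RHS]eq_bigr => i' _.
      rewrite (bigD1 (g i')) //= eqxx andbT big1 ?addn0; last first.
        by move=> j /negbTE; rewrite eq_sym => ->; rewrite andbF.
      over.
    rewrite (bigD1 (g i)) //= eqxx andbT big1 ?addn0; last first.
      by move=> j /negbTE; rewrite eq_sym => ->; rewrite andbF.
    rewrite -{1}fCC; case: (boolP (i \in _)) => [/imsetP[i' iC ->]|iC].
      rewrite (bigD1 i') //= eqxx big1 // => i'' /andP[iC' ii'].
      by rewrite (inj_in_eq fI) // (negbTE ii').
    rewrite big1 // => i' iC'; case: eqP => // fi.
    by case/negP: iC; rewrite -fi imset_f.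
  rewrite /csum; under eq_bigr do rewrite oldE.
  under [RHS]eq_bigr do rewrite newE.
  rewrite exchange_big /= [LHS](bigID (mem C)) /= [X in _ + X]big1 ?addn0.
    apply: eq_bigr => i iC; rewrite iC /= (bigD1 (f i)) //= eqxx big1 ?addn0 //.
    by move=> i' /negbTE; rewrite eq_sym => ->.
  by move=> i /negbTE ->.
(* [new] contains the entry of row [f i] in column [g i], whereas [old] meets that column in row [i]
   only, and [f i] differs from [i]. *)
have /set0Pn[i iC] := C0 => /(congr1 (fun u : mon => u (entry (f i) (g i)))).
rewrite oldE newE (bigD1 i) //= !eqxx /= (inj_eq gI).
by have [_ /negbTE -> _] := fD i (subsetP CD _ iC); rewrite andbF.
Qed.

End Margins.

(** * Transversals and linear syzygies of the optimal matchings *)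

Section MatchingField.

Variables (n m : nat).
Local Notation mon := (monT (entries n m)).
Variable le : rel mon.
Hypothesis hle : term_order le.
Variable col : {set 'I_m} -> 'I_n -> 'I_m.

Definition optimal_matchings := forall a : {set 'I_m}, #|a| = n ->
  [/\ injective (col a), codom (col a) =i a & opt le (mfun (col a))].

Hypothesis colP : optimal_matchings.

(* Optimal among the monomials of degree n in each column and n u_i + n - 1 in
   row i, T has at most u_i entries equal to n in row i, and every column without
   such an entry meets two rows. *)
Lemma small_transversal (u : 'X_{1..n}) : 0 < n <= m -> mdeg u = (m - n).+1 ->
  exists2 B : 'I_n -> {set 'I_m}, forall i, #|B i| <= u i &
    forall a : {set 'I_m}, #|a| = n -> exists i, col a i \in B i.
Proof.
move=> /andP[n0 nm] du.
(* The row degrees add up to n(m - n + 1) + n(n - 1) = nm, the sum of the column degrees. *)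
have [T0 [rT0 cT0]] : exists T : mon, rsum T =1 (fun i => n * u i + n.-1) /\
    csum T =1 (fun=> n).
  apply: margins_exist; rewrite big_split /= -big_distrr /= -mdegE du.
  by rewrite !sum_nat_const !card_ord; nia.
have [T [rT cT] oT] := opt_exists hle T0.
exists (fun i => [set j | T (entry i j) == n]) => [i|a /colP[colI colE colO]].
  have : n * #|[set j | T (entry i j) == n]| <= n * u i + n.-1.
    rewrite -rT0 rT /rsum (bigID (fun j => T (entry i j) == n)) /=.
    rewrite (eq_bigr (fun=> n)); last by move=> j /eqP.
    by rewrite sum_nat_const mulnC -cardsE; apply: leq_addr.
  have aux p c v : 0 < p -> p * c <= p * v + p.-1 -> c <= v by nia.
  exact: aux.
have [/existsP[i Ti]|/existsPn avoid] :=
  boolP [exists i, T (entry i (col a i)) == n]; first by exists i; rewrite inE.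
(* If the matching of [a] avoids all entries equal to n, each of its columns also has an entry in
   another row, and the exchange applies to all rows at once. *)
have /fin_all_exists [f fP] : forall i, exists i', i' != i /\ 0 < T (entry i' (col a i)).
  move=> i; have [/existsP[i' /andP[]]|] :=
    boolP [exists i', (i' != i) && (0 < T (entry i' (col a i)))]; first by exists i'.
  rewrite negb_exists => /forallP H; case/negP: (avoid i).
  have : csum T (col a i) = n by rewrite -cT cT0.
  rewrite /csum (bigD1 i) //= big1 ?addn0 => [/eqP //|i' ii'].
  by apply/eqP; rewrite -leqn0 leqNgt; apply: contra (H i') => ->; rewrite ii'.
exfalso; apply: (exchange hle (D := setT) (f := f) oT colO colI).
  by apply/set0Pn; exists (Ordinal n0).
by move=> i _; have [? ?] := fP i; rewrite inE.
Qed.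

(** Suppose the entry of row [i] in column [col a i] vanishes. Draw an edge from x to y when column
    [col a x] meets row y, and let [Q] be the rows from which [i] can be reached. An edge from [i]
    into [Q] closes a cycle, excluded by [exchange]. Otherwise the columns of the rows in
    [i |: ~: Q] are supported in [~: Q], and comparing degrees gives n(|~: Q| + 1) <= (n + 1)|~: Q|,
    impossible since |~: Q| < n. *)
Lemma opt_matching_support (T : mon) (a b : {set 'I_m}) : opt le T -> #|a| = n -> #|b| = n ->
  rsum T =1 (fun=> n.+1) ->
  (forall j, csum T j = n * (j \in a) + (j \in b)) ->
  (mfun (col a) <= T)%MM.
Proof.
move=> oT /colP[colI colE colO] cb rT cT.
apply: entry_lep => i j; rewrite mfunE; case: eqP => // <- {j}.
rewrite lt0n; apply/negP => /eqP Ti0.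
pose e := [rel x y | 0 < T (entry y (col a x))].
pose Q := [set x | connect e x i].
have iQ : i \in Q by rewrite inE connect0.
have [/existsP[y0 /andP[y0Q iy0]]|] := boolP [exists y in Q, e i y].
  have /fin_all_exists [f fP] : forall x, exists y, x \in Q ->
      [/\ y \in Q, y != x & e x y].
    move=> x; have [->|xi] := eqVneq x i.
      by exists y0 => _; split=> //; apply: contraTneq iy0 => ->; rewrite /= Ti0.
    have [xQ|] := boolP (x \in Q); last by exists x.
    move: xQ; rewrite inE => /connectP[p xp pi].
    case/shortenP: xp pi => [[|y p'] /= + + _ il].
      by rewrite il eqxx in xi.
    case/andP=> exy yp /andP[xyp _]; exists y => _; split=> //.
      by rewrite inE; apply/connectP; exists p'.
    by apply: contraNneq xyp => ->; rewrite mem_head.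
  apply: (exchange hle (D := Q) (f := f) oT colO colI).
    by apply/set0Pn; exists i.
  by move=> x /fP[].
rewrite negb_exists => /forallP noy.
have iQC : i \notin ~: Q by rewrite inE iQ.
have supp x y : x \in i |: ~: Q -> y \in Q -> T (entry y (col a x)) = 0.
  rewrite in_setU1 inE => /orP[/eqP ->|xQ] yQ; apply/eqP; rewrite -leqn0 leqNgt.
    by have := noy y; rewrite yQ.
  apply: contra xQ => xy; rewrite inE; move: yQ; rewrite inE.
  by apply: connect_trans; apply: connect1.
have : \sum_(x in i |: ~: Q) csum T (col a x) <= \sum_(y in ~: Q) rsum T y.
  rewrite [X in X <= _](eq_bigr (fun x => \sum_(y in ~: Q) T (entry y (col a x)))).
    rewrite exchange_big; apply: leq_sum => y _ /=.
    rewrite /rsum -(big_imset (fun j => T (entry y j))) /=; last by move=> ? ? _ _; apply: colI.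
    by rewrite [X in _ <= X](bigID (mem (col a @: (i |: ~: Q)))) /= leq_addr.
  move=> x xQ; rewrite /csum (bigID (mem Q)) /= big1 ?add0n.
    by apply: eq_bigl => y; rewrite in_setC.
  by move=> y; apply: supp.
have : \sum_(x in i |: ~: Q) n <= \sum_(x in i |: ~: Q) csum T (col a x).
  by apply: leq_sum => x _; rewrite cT -colE codom_f muln1 leq_addr.
rewrite (eq_bigr (fun=> n.+1) (fun y _ => rT y)) !sum_nat_const cardsU1 iQC.
have : #|~: Q| < n.
  have := cardsC Q; have : 0 < #|Q| by apply/card_gt0P; exists i.
  by rewrite card_ord; lia.
by nia.
Qed.

(* The matching of b is compared with an optimal T having the margins of
   n times the matching of a plus the matching of b. *)
Lemma edge_exists (a b : {set 'I_m}) : 0 < n -> #|a| = n -> #|b| = n -> a != b ->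
  exists i, col b i \notin a /\ opt le (mfun (col a) + U_(entry i (col b i)))%MM.
Proof.
move=> n0 ca cb ab; have [aI aE aO] := colP ca; have [bI bE bO] := colP cb.
have [T [rT cT] oT] := opt_exists hle (mfun (col a) *+ n + mfun (col b))%MM.
have {}rT i : rsum T i = n.+1 by rewrite -rT rsumD rsumMn !rsum_mfun; lia.
have {}cT j : csum T j = n * (j \in a) + (j \in b).
  by rewrite -cT csumD csumMn !csum_mfun_inj // aE bE mulnC.
have aT := opt_matching_support oT ca cb rT cT.
(* If [T] has a column of [b] outside [a] in the row where [b] puts it, then that variable times the
   matching of [a] divides [T]. *)
have [/existsP[i /andP[bia Ti]]|] :=
    boolP [exists i, (col b i \notin a) && (0 < T (entry i (col b i)))].
  exists i; split=> //; apply: (opt_sub hle oT); apply: entry_lep => i' j.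
  rewrite mnmDE mfunE mnm1E eq_entry.
  have := mnm_lepP aT (entry i' j); rewrite mfunE.
  case: (col a i' =P j) => [aj|_ _]; last first.
    by case: (i =P i') => //= <-; case: eqP => // <-.
  case: (col b i =P j) => [bj|_]; last by rewrite andbF addn0.
  by rewrite bj -aj -aE codom_f in bia.
rewrite negb_exists => /forallP no; exfalso.
have zero i : col b i \notin a -> T (entry i (col b i)) = 0.
  by move=> bia; have := no i; rewrite bia lt0n negbK => /eqP.
(* In the remaining case, consider the rows not filled entirely by their own column of [b]. The
   column degrees force each such column into another row, and as every row has degree n + 1 that
   row is again in [D]. *)
pose D := [set i | T (entry i (col b i)) != n.+1].
have /fin_all_exists [f fP] : forall i, exists i', i \in D ->
    [/\ i' \in D, i' != i & 0 < T (entry i' (col b i))].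
  move=> i; have [|] := boolP (i \in D); last by exists i.
  rewrite inE => iD.
  have [/existsP[i' /andP[ii' Ti']]|] :=
      boolP [exists i', (i' != i) && (0 < T (entry i' (col b i)))].
    exists i' => _; split=> //; rewrite inE; apply: contraTneq Ti' => Ti'.
    have := rT i'; rewrite /rsum (bigD1 (col b i')) //= Ti'.
    rewrite (bigD1 (col b i)) /=; last by rewrite (inj_eq bI) eq_sym.
    by lia.
  rewrite negb_exists => /forallP noi'; exfalso.
  have := cT (col b i); rewrite /csum (bigD1 i) //= big1; last first.
    by move=> i' ii'; have := noi' i'; rewrite ii' lt0n negbK => /eqP.
  rewrite -bE codom_f addn0; have := zero i.
  case: (_ \in a) => /= [_|-> //]; last by rewrite muln0.
  by rewrite muln1 addn1 => Ti; rewrite Ti eqxx in iD.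
apply: (exchange hle (D := D) (f := f) oT bO bI); last by move=> i /fP[].
have /subsetPn[j jb ja] : ~~ (b \subset a).
  by apply: contra ab => ba; rewrite eq_sym eqEcard ba ca cb leqnn.
move: jb; rewrite -bE => /codomP[i ji]; apply/set0Pn; exists i.
by rewrite inE zero -?ji.
Qed.

End MatchingField.

(** * Supports and leading monomials of the maximal minors *)

Section Minors.

Variables (k : fieldType) (n m : nat).
Local Notation mon := (monT (entries n m)).

Lemma mfun_inj (g g' : 'I_n -> 'I_m) : mfun g = mfun g' -> g =1 g'.
Proof.
move=> gg' i; have := congr1 (fun u : mon => u (entry i (g i))) gg'.
by rewrite !mfunE eqxx; case: eqP.
Qed.

Lemma mfun_of_margins (T : mon) (A : {set 'I_m}) :
  (forall i, rsum T i = 1) -> (forall j, csum T j = (j \in A)) ->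
  exists g, [/\ injective g, codom g =i A & T = mfun g].
Proof.
move=> rT cT; have /fin_all_exists [g gP] : forall i, exists j, 0 < T (entry i j).
  move=> i; apply/existsP/contraT => /existsPn T0; have := rT i.
  by rewrite /rsum big1 // => j _; apply/eqP; rewrite -leqn0 leqNgt.
have TE : T = mfun g.
  apply: entryP => i j; rewrite mfunE; have := rT i.
  rewrite /rsum (bigD1 (g i)) //=; case: eqP => [<-|/eqP gj].
    by have := gP i; lia.
  by rewrite (bigD1 j) 1?eq_sym //=; have := gP i; lia.
have gI : injective g.
  move=> i i' gg; apply/eqP; apply/contraT => ii'.
  have := cT (g i); rewrite /csum (bigD1 i) //= (bigD1 i') 1?eq_sym //=.
  by have := gP i; have := gP i'; rewrite -gg; case: (_ \in A); lia.
exists g; split=> // j; have := cT j; rewrite TE csum_mfun_inj //.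
by do 2!case: (_ \in _).
Qed.

(** Distinct permutations give distinct monomials, so nothing cancels in the expansion of the
    determinant. *)
Lemma msupp_minor (a : {set 'I_m}) (u : mon) : #|a| = n ->
  (u \in msupp (minor k n a)) <->
  exists g, [/\ injective g, codom g =i a & u = mfun g].
Proof.
move=> ca; pose h (j : 'I_n) : 'I_m := enum_val (cast_ord (esym ca) j).
have hI : injective h by move=> i j /enum_val_inj /cast_ord_inj.
have hP j : nth (h j) (enum a) j = h j.
  by rewrite /h /enum_val; apply: set_nth_default; rewrite -cardE ca.
have minorE : minor k n a =
    (\sum_(s : 'S_n) (-1) ^+ s * 'X_[mfun (h \o s)])%R.
  rewrite /minor /determinant; apply: eq_bigr => s _; congr (_ * _)%R.
  rewrite /mfun -mprodXE; apply: eq_bigr => i _; rewrite mxE.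
  have -> : onth (enum a) (s i) = Some (h (s i)).
    by rewrite onthE (nth_map (h (s i))) ?hP // -cardE ca.
  by [].
have sh_inj (s s' : 'S_n) : mfun (h \o s) = mfun (h \o s') -> s = s'.
  by move/mfun_inj => hs; apply/permP => i; apply/hI/hs.
rewrite mcoeff_msupp minorE raddf_sum /=; split=> [|[g [gI ga ->]]].
  have [/existsP[s /eqP <-] _|] := boolP [exists s : 'S_n, mfun (h \o s) == u].
    exists (h \o s); split=> // [|j]; first exact/inj_comp/perm_inj.
    apply/codomP/idP => [[i ->]|ja]; first exact: enum_valP.
    exists (s^-1 (cast_ord ca (enum_rank_in ja j)))%g => /=.
    by rewrite permKV /h cast_ordK enum_rankK_in.
  rewrite negb_exists => /forallP no /eqP[]; rewrite big1 // => s _.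
  by rewrite mulr_sign; case: ifP; rewrite ?mcoeffN mcoeffX (negbTE (no s)) ?oppr0.
have /fin_all_exists [s sP] : forall i, exists j, h j = g i.
  move=> i; have gia : g i \in a by rewrite -ga codom_f.
  exists (cast_ord ca (enum_rank_in gia (g i))).
  by rewrite /h cast_ordK enum_rankK_in.
have sI : injective s by move=> i j /(congr1 h); rewrite !sP => /gI.
have gs : mfun g = mfun (h \o perm sI).
  by apply: entryP => i j; rewrite !mfunE /= permE sP.
rewrite gs (bigD1 (perm sI)) //= big1 => [|s' ss'].
  rewrite addr0 mulr_sign; case: ifP; rewrite ?mcoeffN mcoeffX eqxx ?oppr_eq0 ?oner_eq0 //.
have /negbTE ne : mfun (h \o s') != mfun (h \o perm sI).
  by apply: contra ss' => /eqP/sh_inj ->.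
by rewrite mulr_sign; case: ifP => _; rewrite ?mcoeffN mcoeffX ne ?oppr0.
Qed.

Lemma minor_matching (a : {set 'I_m}) : #|a| = n ->
  exists u, u \in msupp (minor k n a).
Proof.
move=> ca; exists (mfun (fun j => enum_val (cast_ord (esym ca) j))).
apply/msupp_minor => //.
have hI : injective (fun j => enum_val (cast_ord (esym ca) j)).
  by move=> i j /enum_val_inj /cast_ord_inj.
exists (fun j => enum_val (cast_ord (esym ca) j)); split=> // j.
apply/codomP/idP => [[i ->]|ja]; first exact: enum_valP.
by exists (cast_ord ca (enum_rank_in ja j)); rewrite cast_ordK enum_rankK_in.
Qed.

Variable le : rel mon.
Hypothesis hle : term_order le.

(** A monomial with the margins of a matching onto [a] is itself such a matching, hence a term of
    the minor; so the largest term is optimal. *)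
Lemma lead_mon_opt (a : {set 'I_m}) : #|a| = n ->
  exists g, [/\ injective g, codom g =i a, opt le (mfun g) &
    lead_mon le (minor k n a) = mfun g].
Proof.
move=> ca; have [u0 us] := minor_matching ca.
have [u [us' _ uE]] := tmax_attained hle id us (isT : predT u0).
have /msupp_minor[//|g [gI ga ug]] := us'.
exists g; split=> // [T [rT cT]|]; last by rewrite -ug -uE.
have [||g' [g'I g'a TE]] := @mfun_of_margins T a.
- by move=> i; rewrite -rT rsum_mfun.
- by move=> j; rewrite -cT csum_mfun_inj // ga.
rewrite -ug -uE; apply: (tmax_ge hle id) => //; apply/msupp_minor => //.
by exists g'.
Qed.

Lemma lead_matchings (hnm : n <= m) : exists col : {set 'I_m} -> 'I_n -> 'I_m,
  optimal_matchings le col /\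
  forall a : {set 'I_m}, #|a| = n -> lead_mon le (minor k n a) = mfun (col a).
Proof.
have /fin_all_exists [col colP] : forall a : {set 'I_m}, exists g : 'I_n -> 'I_m,
    #|a| = n -> [/\ injective g, codom g =i a, opt le (mfun g) &
    lead_mon le (minor k n a) = mfun g].
  move=> a; have [/lead_mon_opt [g gP]|ca] := eqVneq #|a| n; first by exists g.
  (* For sets of the wrong size any function serves as a value. *)
  by exists (widen_ord hnm) => /eqP; rewrite (negbTE ca).
by exists col; split=> a ca; have [] := colP a ca.
Qed.

End Minors.

(** * Multidegrees of the Eagon-Northcott complex *)

Section EagonNorthcott.

Variables (k : fieldType) (n m : nat).
Local Notation mon := (monT (entries n m)).
Local Notation basis := (en_basis n m).
Variable le : rel mon.
Hypothesis hle : term_order le.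
Hypothesis hn : 0 < n.

Implicit Types (e f : basis).

Definition cols e : {set 'I_m} := if e is Some x then (val x).1 else set0.
Definition wt e : 'X_{1..n} := if e is Some x then (val x).2 : 'X_{1..n} else 0%MM.

Lemma basis_eq e f : 0 < en_degree e -> 0 < en_degree f ->
  cols e = cols f -> wt e = wt f -> e = f.
Proof.
case: e f => [[[A u] Au]|] // [[[B v] Bv]|] //= _ _ AB uv.
congr Some; apply: val_inj; congr pair => //; exact: val_inj.
Qed.

Lemma degreeE e : 0 < en_degree e -> en_degree e = (mdeg (wt e)).+1.
Proof. by case: e. Qed.

Lemma card_cols e : 0 < en_degree e -> #|cols e| = n + mdeg (wt e).
Proof. by case: e => [[[A u] /= /eqP]|]. Qed.

Lemma basis_exists (A : {set 'I_m}) (u : 'X_{1..n}) : #|A| = n + mdeg u ->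
  exists e, [/\ 0 < en_degree e, cols e = A & wt e = u].
Proof.
move=> Au; have ub : mdeg u < m.+1.
  by rewrite ltnS (leq_trans (leq_addl n _)) // -Au (leq_trans (max_card _)) ?card_ord.
have Au' : #|(A, BMultinom ub).1| == n + mdeg (A, BMultinom ub).2 by apply/eqP.
by exists (Some (exist _ (A, BMultinom ub) Au')).
Qed.

Lemma msupp_en_coef e f u : 0 < en_degree f ->
  u \in msupp (en_coef k e f) <-> exists i j,
    [/\ j \in cols e, cols f = cols e :\ j, wt e = (wt f + U_(i))%MM &
        u = U_(entry i j)%MM].
Proof.
case: e f => [[[A v] Av]|] [[[B w] Bw]|] //= _; last first.
  by rewrite msupp0; split=> // -[i [j [+ _ _ _]]]; rewrite inE.
pose P i j := (B == A :\ j) && ((v : 'X_{1..n}) == (w + U_(i))%MM).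
have cE (i : 'I_n) (j : 'I_m) c : (((-1) ^+ c * var k (i, j) : polyT k _)@_u)%R =
    ((-1) ^+ c * (U_(entry i j)%MM == u)%:R)%R.
  rewrite -[in LHS]signr_odd -[in RHS]signr_odd !mulr_sign.
  by case: ifP => _; rewrite ?mcoeffN mcoeffX.
rewrite mcoeff_msupp raddf_sum /=; split=> [|[i [j [jA Bj vw ->]]]].
  have [/existsP[i /existsP[j /andP[jA /andP[/andP[/eqP Bj /eqP vw] /eqP ue]]]] _|] :=
    boolP [exists i, exists j, [&& j \in A, P i j & U_(entry i j)%MM == u]].
    by exists i, j.
  rewrite negb_exists => /forallP no /eqP[]; rewrite big1 // => i _.
  rewrite raddf_sum big1 //= => j /andP[jA Pij]; rewrite cE //.
  have := no i; rewrite negb_exists => /forallP/(_ j).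
  by rewrite jA /P Pij /= => /negbTE ->; rewrite mulr0.
rewrite (bigD1 i) //= [X in (_ + X)%R]big1 ?addr0.
  rewrite raddf_sum (bigD1 j) /=; last by rewrite jA Bj vw !eqxx.
  rewrite big1 ?addr0; first last.
    move=> j' /andP[_ jj']; rewrite -signr_odd mulr_sign.
    by case: ifP; rewrite ?mcoeffN mcoeffX eq_mnm1 eq_entry eqxx (negbTE jj') ?oppr0.
  rewrite -signr_odd mulr_sign.
  by case: ifP => _; rewrite ?mcoeffN mcoeffX eqxx ?oppr_eq0 oner_eq0.
move=> i' ii'; rewrite raddf_sum big1 //= => j' _.
rewrite -signr_odd mulr_sign.
by case: ifP; rewrite ?mcoeffN mcoeffX eq_mnm1 eq_entry (negbTE ii') ?oppr0.
Qed.

(** The margins of a multidegree: row [i] gets [wt e i] variables from the divided power and one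
    more from the minor, and every column of [e] is used once. *)
Definition shape e (T : mon) :=
  (forall i, rsum T i = (wt e i).+1) /\ (forall j, csum T j = (j \in cols e)).

Lemma shape_margins e T T' : shape e T -> same_margins T T' -> shape e T'.
Proof. by case=> r c [rr cc]; split=> x; rewrite -?rr -?cc. Qed.

Lemma shape_same e T T' : shape e T -> shape e T' -> same_margins T T'.
Proof. by case=> r c [r' c']; split=> x; rewrite ?r ?r' ?c ?c'. Qed.

Local Notation M := (en_multidegree k le).

Lemma shape_step e f i j T : cols f = cols e :\ j -> j \in cols e ->
  wt e = (wt f + U_(i))%MM -> shape f T <-> shape e (U_(entry i j) + T)%MM.
Proof.
move=> cf je we; split=> -[rT cT]; split=> x.
- by rewrite rsumD rsumU rT we mnmDE mnm1E addnS addnC.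
- rewrite csumD csumU cT cf !inE eq_sym; case: eqP => [->|_] //=.
  by rewrite je.
- have := rT x; rewrite rsumD rsumU we mnmDE mnm1E; lia.
- have := cT x; rewrite csumD csumU cf !inE eq_sym; case: eqP => [->|_] //=.
  by rewrite je => -[].
Qed.

Lemma multidegree_rec e l : en_degree e = l.+1 -> M e =
  \big[tmax le/0%MM]_(f : basis | en_degree f == l)
    \big[tmax le/0%MM]_(u <- msupp (en_coef k e f)) (u + M f)%MM.
Proof.
by move=> el; rewrite /en_multidegree el /=; apply: eq_bigr => f /eqP <-.
Qed.

Lemma multidegree_ge e f u : en_degree e = (en_degree f).+1 ->
  u \in msupp (en_coef k e f) -> le (u + M f)%MM (M e).
Proof.
move=> ef uc; rewrite (multidegree_rec ef).
apply: (to_trans hle (v := \big[tmax le/0%MM]_(u <- msupp (en_coef k e f)) (u + M f)%MM)).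
  exact: (tmax_ge hle (fun u => (u + M f)%MM)).
exact: (tmax_ge hle (P := fun g => en_degree g == en_degree f)
  (fun g => \big[tmax le/0%MM]_(u <- msupp (en_coef k e g)) (u + M g)%MM)
  (mem_index_enum f) (eqxx (en_degree f))).
Qed.

Lemma multidegree_attained e f u : en_degree e = (en_degree f).+1 ->
  u \in msupp (en_coef k e f) -> exists f' u',
    [/\ en_degree f' = en_degree f, u' \in msupp (en_coef k e f') &
        M e = (u' + M f')%MM].
Proof.
move=> ef uc.
have [f' [_ /eqP ff' Me]] := tmax_attained hle
  (P := fun g => en_degree g == en_degree f)
  (fun f => \big[tmax le/0%MM]_(u <- msupp (en_coef k e f)) (u + M f)%MM)
  (mem_index_enum f) (eqxx (en_degree f)).
rewrite -(multidegree_rec ef) in Me.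
case E: (msupp (en_coef k e f')) => [|u' s].
  (* If [f'] contributes no term, the maximum is the default 0, and then the given term, being at
     most 0, attains it too. *)
  exists f, u; split=> //; apply: (to_anti hle); last exact: multidegree_ge.
  by rewrite Me E big_nil; apply: to_ge0.
have u'c : u' \in msupp (en_coef k e f') by rewrite E mem_head.
have [u'' [u''c _ Me']] := tmax_attained hle (fun u => (u + M f')%MM) u'c
  (isT : predT u').
by exists f', u''; split=> //; rewrite Me Me'.
Qed.

Lemma basis_step e i j : 1 < en_degree e -> j \in cols e -> 0 < wt e i ->
  exists f, [/\ en_degree e = (en_degree f).+1, cols f = cols e :\ j,
    wt e = (wt f + U_(i))%MM & 0 < en_degree f].
Proof.
move=> e1 je wi; have we : wt e = ((wt e - U_(i)) + U_(i))%MM.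
  by rewrite submK // lep1mP -lt0n.
have e0 : 0 < en_degree e by apply: ltn_trans e1.
have cA : #|cols e :\ j| = n + mdeg (wt e - U_(i))%MM.
  have := card_cols e0; rewrite (cardsD1 j) je [in RHS]we mdegD mdeg1; lia.
have [f [f0 cf wf]] := basis_exists cA.
exists f; split; rewrite ?wf //.
by rewrite (degreeE e0) (degreeE f0) [in LHS]we mdegD mdeg1 addn1 wf.
Qed.

(** In degree 1 the terms of the minor are exactly the monomials of the right shape. Above that, any
    entry of such a monomial lying in a row of positive weight can be split off, leaving the shape
    of a basis element in the boundary, so the recursive maximum runs over all monomials of the
    shape. *)
Lemma multidegree_shape e : 0 < en_degree e ->
  shape e (M e) /\ forall T, shape e T -> le T (M e).
Proof.
move: {2}(en_degree e).-1 (erefl (en_degree e).-1) => l.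
elim: l e => [|l IH] e el e0.
  have e1 : en_degree e = (en_degree (None : basis)).+1 by rewrite /=; lia.
  have w0 : wt e = 0%MM.
    by apply/eqP; rewrite -mdeg_eq0 -eqSS -degreeE // e1.
  have ce : #|cols e| = n by rewrite card_cols // w0 mdeg0 addn0.
  have cN : en_coef k e None = minor k n (cols e) by case: e e1 {el e0 w0 ce} => [x|] //= ->.
  have MN : M None = 0%MM by [].
  have mE u : u \in msupp (en_coef k e None) <-> shape e u.
    rewrite cN msupp_minor //; split=> [[g [gI ga ->]]|[ru cu]].
      split=> x; first by rewrite rsum_mfun w0 mnm0E.
      by rewrite csum_mfun_inj // ga.
    by apply: mfun_of_margins => // i; rewrite ru w0 mnm0E.
  have [u0 u0P] := minor_matching k ce; rewrite -cN in u0P.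
  have [f' [u' [f'0 u'c Me]]] := multidegree_attained e1 u0P.
  have fN : f' = None by case: f' f'0 {u'c Me}.
  rewrite fN in u'c; split=> [|T /mE Tc]; first by rewrite Me fN MN addm0; exact/mE.
  by have := multidegree_ge e1 Tc; rewrite MN addm0.
have e1 : 1 < en_degree e by lia.
have [i wi] : exists i, 0 < wt e i.
  apply/existsP/contraT => /existsPn w0; move: e1; rewrite degreeE //.
  by rewrite mdegE big1 // => i _; apply/eqP; rewrite -leqn0 leqNgt.
have ref f : en_degree e = (en_degree f).+1 -> l = (en_degree f).-1.
  by move=> ef; rewrite -[l]/(l.+1.-1) -el ef.
have pos f : en_degree e = (en_degree f).+1 -> 0 < en_degree f.
  by move=> ef; rewrite ef in e1.
split=> [|T sT].
  have [j je] : exists j, j \in cols e.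
    by apply/set0Pn; rewrite -card_gt0 card_cols //; lia.
  have [f [ef cf wf f0]] := basis_step e1 je wi.
  have uc : U_(entry i j)%MM \in msupp (en_coef k e f).
    by apply/msupp_en_coef => //; exists i, j.
  have [f' [u' [ff' u'c ->]]] := multidegree_attained ef uc.
  have ef' : en_degree e = (en_degree f').+1 by rewrite ff'.
  have [i' [j' [je' cf' wf' ->]]] := (msupp_en_coef e u' (pos _ ef')).1 u'c.
  apply/(shape_step _ cf' je' wf').
  by have [] := IH f' (esym (ref _ ef')) (pos _ ef').
have [j Tj] : exists j, 0 < T (entry i j).
  apply/existsP/contraT => /existsPn T0; have [/(_ i) + _] := sT.
  by rewrite /rsum big1 // => j _; apply/eqP; rewrite -leqn0 leqNgt.
have je : j \in cols e.
  have [_ /(_ j)] := sT; have := entry_le_csum T i j.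
  by case: (_ \in _) => //; lia.
have [f [ef cf wf f0]] := basis_step e1 je wi.
have TE : T = (U_(entry i j) + (T - U_(entry i j)))%MM.
  by rewrite addmC submK // lep1mP -lt0n.
have sf : shape f (T - U_(entry i j))%MM.
  by apply/(shape_step _ cf je wf); rewrite -TE.
have [_ /(_ _ sf) leT] := IH f (esym (ref _ ef)) f0.
have uc : U_(entry i j)%MM \in msupp (en_coef k e f).
  by apply/msupp_en_coef => //; exists i, j.
apply: to_trans (multidegree_ge ef uc) => //.
by rewrite TE addmC [X in le _ X]addmC; apply: to_add.
Qed.

Lemma multidegree_opt e : 0 < en_degree e -> opt le (M e).
Proof.
move=> e0; have [sM maxM] := multidegree_shape e0.
by move=> T MT; apply: maxM; apply: shape_margins MT.
Qed.

Lemma multidegree_unique e T : 0 < en_degree e -> shape e T -> opt le T -> M e = T.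
Proof.
move=> e0 sT oT; have [sM _] := multidegree_shape e0.
by apply: (opt_unique hle) => //; [apply: multidegree_opt|apply: shape_same sM sT].
Qed.

Lemma sparse_en_coef_neq0 e f : (sparse_en_coef k le e f != 0)%R <->
  exists2 u, u \in msupp (en_coef k e f) & (u + M f)%MM = M e.
Proof.
have cE v : ((sparse_en_coef k le e f)@_v)%R =
    if (v \in msupp (en_coef k e f)) && ((v + M f)%MM == M e)
    then ((en_coef k e f)@_v)%R else 0%R.
  rewrite raddf_sum /= big_mkcond.
  have [vc|vc] := boolP (v \in msupp _); last first.
    rewrite big1_seq //= => u uc; case: ifP => // _.
    rewrite mcoeffZ mcoeffX; case: eqP => [uv|_]; last by rewrite mulr0.
    by rewrite -uv uc in vc.
  rewrite (bigD1_seq v) ?msupp_uniq //= mcoeffZ mcoeffX eqxx mulr1 big1 ?addr0 //.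
  by move=> u /negbTE uv; case: ifP => // _; rewrite mcoeffZ mcoeffX uv mulr0.
split=> [sp|[u uc uM]]; last first.
  apply/eqP => sp0; have := cE u; rewrite sp0 mcoeff0 uc uM eqxx /= => /esym/eqP.
  by rewrite mcoeff_eq0 uc.
have [v] : exists v, v \in msupp (sparse_en_coef k le e f).
  case E : (msupp _) => [|v s]; last by exists v; rewrite mem_head.
  by move: sp; rewrite -msupp_eq0 E.
rewrite mcoeff_msupp cE; case: ifP => [/andP[vc /eqP vM] _|_]; last by rewrite eqxx.
by exists v.
Qed.

Lemma po_le_mon e f : po_le k le f e -> (M f <= M e)%MM /\ en_degree f <= en_degree e.
Proof.
case/connectP => p; elim: p e => [|g p IH] e /=.
  by move=> _ ->; rewrite lepm_refl leqnn.
case/andP => /andP[/eqP eg /sparse_en_coef_neq0 [u _ uM]] gp fl.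
have [fg dg] := IH g gp fl; split; last by rewrite eg ltnW.
by rewrite -uM; apply: lepm_trans fg _; apply: lem_addl.
Qed.

Lemma po_le_degree_eq e f : po_le k le f e -> en_degree e <= en_degree f -> e = f.
Proof.
case/connectP => -[|g p] /=; first by move=> _ ->.
case/andP => /andP[/eqP eg _] gp fl; rewrite eg.
have /po_le_mon[_ fg] : po_le k le f g by apply/connectP; exists p.
by rewrite leqNgt ltnS fg.
Qed.

(** Dividing the multidegree of [e] by the variable leaves an optimal monomial of the shape of [f],
    hence the multidegree of [f]; this is exactly when the term survives setting t = 0. *)
Lemma po_step e i j : 0 < M e (entry i j) -> 0 < wt e i -> 1 < en_degree e ->
  exists f, [/\ po_le k le f e, en_degree e = (en_degree f).+1,
    cols f = cols e :\ j, wt e = (wt f + U_(i))%MM &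
    M e = (U_(entry i j) + M f)%MM].
Proof.
move=> Mij wi e1; have e0 := ltnW e1.
have [sM maxM] := multidegree_shape e0.
have je : j \in cols e.
  have [_ /(_ j)] := sM; have := entry_le_csum (M e) i j.
  by case: (_ \in _) => //; lia.
have [f [ef cf wf f0]] := basis_step e1 je wi.
have ME : M e = (U_(entry i j) + (M e - U_(entry i j)))%MM.
  by rewrite addmC submK // lep1mP -lt0n.
have Mf : M f = (M e - U_(entry i j))%MM.
  apply: multidegree_unique => //; first by apply/(shape_step _ cf je wf); rewrite -ME.
  by apply: (opt_sub hle (multidegree_opt e0)); apply: lem_subr.
exists f; split; rewrite ?Mf //; apply: connect1; rewrite ef eqxx /=.
apply/sparse_en_coef_neq0; exists U_(entry i j)%MM; last by rewrite Mf.
by apply/msupp_en_coef => //; exists i, j.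
Qed.

Lemma vertexP (a : {set 'I_m}) : #|a| = n ->
  [/\ en_degree (vertex n a) = 1, cols (vertex n a) = a & wt (vertex n a) = 0%MM].
Proof.
move=> ca; rewrite /vertex; case: insubP => [x _ xE|/=]; last first.
  by rewrite mdeg0 addn0 ca eqxx.
by rewrite /= xE /= mdeg0.
Qed.

Lemma vertex_of e : en_degree e = 1 -> #|cols e| = n /\ e = vertex n (cols e).
Proof.
move=> e1; have e0 : 0 < en_degree e by rewrite e1.
have w0 : wt e = 0%MM by apply/eqP; rewrite -mdeg_eq0 -eqSS -degreeE // e1.
have ce : #|cols e| = n by rewrite card_cols // w0 mdeg0 addn0.
have [v1 cv wv] := vertexP ce.
by split=> //; apply: basis_eq; rewrite ?v1 ?cv ?wv.
Qed.

Variable col : {set 'I_m} -> 'I_n -> 'I_m.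
Hypothesis colP : optimal_matchings le col.

Lemma multidegree_vertex (a : {set 'I_m}) : #|a| = n -> M (vertex n a) = mfun (col a).
Proof.
move=> ca; have [v1 cv wv] := vertexP ca; have [cI cE cO] := colP ca.
apply: multidegree_unique => //; first by rewrite v1.
split=> x; first by rewrite rsum_mfun wv mnm0E.
by rewrite csum_mfun_inj // cE cv.
Qed.

(** Variables not chosen by [g] are stripped by [po_step] until a vertex is left. A row of positive
    weight has degree at least 2 and entries at most 1, so it contains a variable other than the
    chosen one. *)
Lemma po_transversal e (g : 'I_n -> 'I_m) : 0 < en_degree e ->
  (forall i, 0 < M e (entry i (g i))) -> exists a : {set 'I_m},
    [/\ #|a| = n, po_le k le (vertex n a) e & col a =1 g].
Proof.
move: {2}(en_degree e).-1 (erefl (en_degree e).-1) => l.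
elim: l e => [|l IH] e el e0 Mg.
  have e1 : en_degree e = 1 by lia.
  have [ce ve] := vertex_of e1; exists (cols e); split=> //.
    by rewrite -ve; apply: connect0.
  move=> i; have := Mg i.
  have -> : M e = mfun (col (cols e)) by rewrite [in LHS]ve multidegree_vertex.
  by rewrite mfunE; case: eqP.
have e1 : 1 < en_degree e by lia.
have [i wi] : exists i, 0 < wt e i.
  apply/existsP/contraT => /existsPn w0; move: e1; rewrite degreeE //.
  by rewrite mdegE big1 // => i _; apply/eqP; rewrite -leqn0 leqNgt.
have [[rM cM] _] := multidegree_shape e0.
have [j ji Mj] : exists2 j, j != g i & 0 < M e (entry i j).
  apply/exists_inP/contraT => /exists_inPn M0.
  have := rM i; rewrite /rsum (bigD1 (g i)) //= big1 => [|j /M0].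
    have := entry_le_csum (M e) i (g i); rewrite cM; case: (_ \in _) => /=; lia.
  by rewrite lt0n negbK => /eqP.
have [f [fe ef cf wf Mf]] := po_step Mj wi e1.
have [||i'|a [ca va ag]] := IH f; try lia.
  have := Mg i'; rewrite Mf mnmDE mnm1E eq_entry.
  by case: eqP => [<-|//]; rewrite (negbTE ji).
by exists a; split=> //; apply: connect_trans va.
Qed.

(** The cell has columns [j |: a] and weight [U_(i)]. Optimality identifies its multidegree, and
    stripping the variable in row [i] and column [j] gives back the vertex. *)
Lemma edge_basis (a : {set 'I_m}) i j : #|a| = n -> j \notin a ->
  opt le (mfun (col a) + U_(entry i j))%MM -> exists e,
  [/\ 1 < en_degree e, po_le k le (vertex n a) e &
      M e = (mfun (col a) + U_(entry i j))%MM].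
Proof.
move=> ca ja oa; have [cI cE cO] := colP ca.
have cA : #|j |: a| = n + mdeg (U_(i)%MM : 'X_{1..n}).
  by rewrite cardsU1 ja ca mdeg1 addnC.
have [e [e0 ce we]] := basis_exists cA.
have Me : M e = (mfun (col a) + U_(entry i j))%MM.
  apply: multidegree_unique => //; split=> x.
    by rewrite rsumD rsum_mfun rsumU we mnm1E.
  rewrite csumD csum_mfun_inj // cE csumU ce !inE eq_sym.
  by case: eqP => [->|_]; rewrite ?(negbTE ja) ?addn0.
have e1 : 1 < en_degree e by rewrite degreeE // we mdeg1.
exists e; split=> //.
have [||f [fe ef cf wf Mf]] := @po_step e i j _ _ e1.
- by rewrite Me mnmDE mnm1E eqxx addn1.
- by rewrite we mnm1E eqxx.
suff -> : vertex n a = f by [].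
have [v1 cv wv] := vertexP ca; apply: basis_eq; rewrite ?v1 ?cv ?wv //.
- by rewrite ef in e1.
- by rewrite cf ce setU1K.
- by move: wf; rewrite we -[LHS]add0m => /addIm.
Qed.

End EagonNorthcott.

(** * Deleting a free vertex *)

Section FreeSequences.

Variables (k : fieldType) (n m : nat).
Local Notation mon := (monT (entries n m)).
Local Notation basis := (en_basis n m).
Variable le : rel mon.
Hypothesis hle : term_order le.
Hypothesis hn : 0 < n.
Hypothesis hnm : n <= m.
Variable col : {set 'I_m} -> 'I_n -> 'I_m.
Hypothesis colP : optimal_matchings le col.

Local Notation M := (en_multidegree k le).
Implicit Types (V : {set {set 'I_m}}) (a b c : {set 'I_m}).

Definition shift_col a i (j : 'I_m) i' := if i' == i then j else col a i'.

(* The monomials of the vertices in V have linear first syzygies, given by edges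
   between vertices in V. *)
Definition linked V := forall a b, a \in V -> b \in V -> a != b -> exists i c,
  [/\ col b i \notin a, opt le (mfun (col a) + U_(entry i (col b i)))%MM,
      c \in V & col c =1 shift_col a i (col b i)].

(* The exponents outside the ideal obtained from the Alexander dual by collapsing
   each row to one variable all occur in a list of length #|V|. *)
Definition few_standard V := exists2 U : seq 'X_{1..n}, size U = #|V| &
  forall u : 'X_{1..n}, (forall B : 'I_n -> {set 'I_m}, (forall i, #|B i| <= u i) ->
     exists2 a, a \in V & forall i, col a i \notin B i) -> u \in U.

Definition nsubsets : {set {set 'I_m}} := [set a : {set 'I_m} | #|a| == n].

Lemma col_inj a b : #|a| = n -> #|b| = n -> col a =1 col b -> a = b.
Proof.
move=> /colP[_ aE _] /colP[_ bE _] ab; apply/setP => j.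
by rewrite -aE -bE; congr (_ \in _); rewrite /codom (eq_image (frefl _) ab).
Qed.

(** [edge_exists] yields an edge cell at [a]; its other end is the transversal using the new
    variable in row [i]. *)
Lemma linked_nsubsets : linked nsubsets.
Proof.
move=> a b; rewrite !inE => /eqP ca /eqP cb ab.
have [i [bia ob]] := edge_exists hle colP hn ca cb ab; exists i.
have [e [e1 ae Me]] := edge_basis k hle hn colP ca bia ob.
have [|i'|c [cc ce cE]] := @po_transversal k n m le hle hn col colP e
  (shift_col a i (col b i)); first exact: ltnW.
  rewrite Me mnmDE mfunE mnm1E eq_entry /shift_col.
  by have [->|ii'] := eqVneq i' i; rewrite !eqxx ?addn1.
by exists c; split=> //; rewrite inE cc.
Qed.

Lemma mnm_truncate p (u : 'X_{1..p}) d : d <= mdeg u ->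
  exists2 v : 'X_{1..p}, (v <= u)%MM & mdeg v = d.
Proof.
elim: d => [|d IH] du; first by exists 0%MM; rewrite ?mdeg0 //; apply/mnm_lepP => i; rewrite mnm0E.
have [v vu vd] := IH (ltnW du).
have [i vi] : exists i, v i < u i.
  apply/existsP/contraT => /existsPn uv; move: du.
  rewrite -vd !mdegE ltnNge leq_sum // => i _.
  by rewrite leqNgt uv.
exists (v + U_(i))%MM; last by rewrite mdegD mdeg1 vd addn1.
apply/mnm_lepP => j; rewrite mnmDE mnm1E; have := mnm_lepP vu j.
by case: eqP => [<- _|_]; rewrite ?addn1 ?addn0.
Qed.

Lemma few_standard_nsubsets : few_standard nsubsets.
Proof.
(* These tuples are the exponents of degree at most m - n, of which there are binom(m, n). *)
pose D := [set t : n.-tuple 'I_(m - n).+1 | \sum_(i <- t) i <= m - n].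
exists [seq [multinom val (tnth t i) | i < n] | t <- enum D].
  rewrite size_map -cardE card_partial_ord_partitions subnKC //.
  by rewrite /nsubsets card_draws card_ord.
move=> u uP; have [du|du] := leqP (mdeg u) (m - n).
  have ui i : u i <= m - n.
    by apply: leq_trans du; rewrite mdegE (bigD1 i) //= leq_addr.
  apply/mapP; exists [tuple inord (u i) | i < n].
    rewrite mem_enum inE big_tuple; apply: leq_trans du; rewrite mdegE.
    by apply: leq_sum => i _; rewrite tnth_mktuple inordK // ltnS.
  by apply/mnmP => i; rewrite mnmE tnth_mktuple /= inordK // ltnS.
(* An exponent of larger degree dominates one of degree exactly m - n + 1, to which
   [small_transversal] applies. *)
have [v vu vd] := mnm_truncate du.
have [|B Bv hit] := small_transversal hle colP _ vd; first by rewrite hn.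
have [|a] := uP B.
  by move=> i; apply: leq_trans (Bv i) (mnm_lepP vu i).
rewrite inE => /eqP /hit [i ai] /(_ i); by rewrite ai.
Qed.

(** The subcomplex left after deleting the vertices outside [V], including the degree 0 element as
    its empty face. *)
Definition remaining V : {set basis} :=
  [set e | [forall a, (a \in nsubsets :\: V) ==> ~~ po_le k le (vertex n a) e]].

Lemma remainingP V e : e \in remaining V ->
  forall a, #|a| = n -> po_le k le (vertex n a) e -> a \in V.
Proof.
rewrite inE => /forallP eV a ca ae; apply: contraT => aV.
by have := eV a; rewrite !inE aV ca eqxx ae.
Qed.

(** * The unique facet through a free vertex *)

Section FreeVertex.

Variables (V : {set {set 'I_m}}) (a : {set 'I_m}).
Hypothesis subV : V \subset nsubsets.
Hypothesis linkV : linked V.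
Hypothesis ca : #|a| = n.
Hypothesis freea : free_vertex (po_le k le) (fun e => en_degree e == 1)
   (remaining V) (vertex n a).

Lemma card_V b : b \in V -> #|b| = n.
Proof. by move/(subsetP subV); rewrite inE => /eqP. Qed.

Lemma free_in : a \in V.
Proof.
by case/and3P: freea => aX _ _; apply: (remainingP aX) => //; apply: connect0.
Qed.

(** A remaining face of largest degree above [e] is maximal, because the degree increases strictly
    along the order; it contains [a], so it is [F]. *)
Lemma free_facet : exists F, [/\ F \in remaining V, po_le k le (vertex n a) F &
  forall e, e \in remaining V -> po_le k le (vertex n a) e -> po_le k le e F].
Proof.
case/and3P: freea => aX _ /cards1P[F FP].
have: F \in [set F] by rewrite set11.
rewrite -FP inE => /andP[/andP[FX _] aF]; exists F; split=> // e eX ae.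
pose P G := (G \in remaining V) && po_le k le e G.
have Pe : P e by rewrite /P eX; apply: connect0.
case: (@arg_maxnP _ e P (@en_degree n m) Pe) => G /andP[GX eG] Gmax.
suff : G \in [set F] by rewrite inE => /eqP <-.
have aG : po_le k le (vertex n a) G := connect_trans eG ae.
rewrite -FP inE aG andbT /maximal_face GX /=.
apply/forallP => H; apply/implyP => HX; apply/implyP => GH; apply/eqP.
apply: (po_le_degree_eq GH); apply: Gmax; rewrite /P HX.
exact: connect_trans GH eG.
Qed.

Variable F : basis.
Hypothesis FX : F \in remaining V.
Hypothesis aF : po_le k le (vertex n a) F.
Hypothesis maxF : forall e, e \in remaining V -> po_le k le (vertex n a) e ->
  po_le k le e F.

Lemma degF : 0 < en_degree F.
Proof.
by have [_] := po_le_mon aF; have [-> _ _] := vertexP ca.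
Qed.

Lemma facet_transversal (g : 'I_n -> 'I_m) :
  (forall i, 0 < M F (entry i (g i))) -> exists2 c, c \in V & col c =1 g.
Proof.
move=> /(po_transversal hle hn colP degF) [c [cc cF cg]].
by exists c => //; apply: (remainingP FX).
Qed.

Lemma facet_free i : 0 < M F (entry i (col a i)).
Proof.
have [/mnm_lepP/(_ (entry i (col a i))) + _] := po_le_mon aF.
by rewrite (multidegree_vertex k hle hn colP ca) mfunE eqxx.
Qed.

(** The link from [a] towards [b] is an edge cell whose only vertices are [a] and [c], both in [V].
    The cell therefore remains and lies in [F], so its new variable divides the multidegree of
    [F]. *)
Lemma facet_hit b : b \in V -> b != a -> exists2 i,
  col b i \notin a & 0 < M F (entry i (col b i)).
Proof.
move=> bV ba; have [|i [c [bia oc cV cE]]] := linkV free_in bV; first by rewrite eq_sym.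
have [e [e1 ae Me]] := edge_basis k hle hn colP ca bia oc.
have eX : e \in remaining V.
  rewrite inE; apply/forallP => w; rewrite !inE; apply/implyP => /andP[wV /eqP cw].
  apply/negP => /po_le_mon [we _]; case/negP: wV.
  have wE i' : (col w i' == col a i') || (i' == i) && (col w i' == col b i).
    have := mnm_lepP we (entry i' (col w i')).
    rewrite (multidegree_vertex k hle hn colP cw) Me mnmDE !mfunE mnm1E eq_entry eqxx.
    by rewrite [_ == col a i']eq_sym [i' == i]eq_sym [_ == col b i]eq_sym; do 3!case: eqP.
  have [wi|wi] := eqVneq (col w i) (col b i).
    suff -> : w = c by [].
    apply: col_inj => //; first exact: card_V.
    move=> i'; rewrite cE /shift_col; have := wE i'.
    by have [->|_] := eqVneq i' i; rewrite ?wi // orbF => /eqP.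
  suff -> : w = a by exact: free_in.
  apply: col_inj => // i'; have := wE i'.
  by have [->|_] := eqVneq i' i; rewrite ?(negbTE wi) orbF => /eqP.
exists i => //; have [/mnm_lepP/(_ (entry i (col b i))) + _] := po_le_mon (maxF eX ae).
by rewrite Me mnmDE mnm1E eqxx addn1; apply: leq_trans.
Qed.

Lemma csum_facet j : csum (M F) j <= 1.
Proof.
have [[_ cF] _] := multidegree_shape k hle hn degF.
by rewrite cF leq_b1.
Qed.

Lemma facet_col_inj i i' j : 0 < M F (entry i j) -> 0 < M F (entry i' j) -> i = i'.
Proof.
move=> ij i'j; apply/eqP/contraT => ii'; have := csum_facet j.
by rewrite /csum (bigD1 i) //= (bigD1 i') 1?eq_sym //=; lia.
Qed.

Lemma card_facet_row i : #|[set j | 0 < M F (entry i j)]| = (wt F i).+1.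
Proof.
have [[rF _] _] := multidegree_shape k hle hn degF; rewrite -rF.
rewrite -sum1dep_card /rsum [LHS]big_mkcond; apply: eq_bigr => j _.
have := leq_trans (entry_le_csum (M F) i j) (csum_facet j).
by case: (M F _) => [|[|]].
Qed.

(** Only a link from [b] to [d] passing through [a] is lost. Then [a] and [b] differ in row [i]
    alone, so [facet_hit] places all of [b] in [F]. It also gives a row [i'] in which [d] lies in
    [F] outside [a]. Replacing the column of [b] in row [i'] by that of [d] stays inside [F], hence
    gives a vertex of [V], and this vertex is not [a]. *)
Lemma linked_free : linked (V :\ a).
Proof.
move=> b d; rewrite !inE => /andP[ba bV] /andP[da dV] bd.
have [i [c [dib oc cV cE]]] := linkV bV dV bd.
have [eca|neca] := eqVneq c a; last by exists i, c; rewrite !inE neca.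
rewrite eca in cE.
have [i0 bi0 Fb] := facet_hit bV ba.
have i0i : i0 = i.
  apply/eqP; apply: contraNT bi0 => i0i.
  have [_ aE _] := colP ca; rewrite -aE; apply/codomP; exists i0.
  by rewrite cE /shift_col (negbTE i0i).
rewrite {}i0i in bi0 Fb.
have [i' di' Fd] := facet_hit dV da.
have i'i : i' != i.
  apply: contraNneq di' => ->; have [_ aE _] := colP ca; rewrite -aE.
  by apply/codomP; exists i; rewrite cE /shift_col eqxx.
have FB x : 0 < M F (entry x (col b x)).
  have [->//|xi] := eqVneq x i.
  by have := facet_free x; rewrite cE /shift_col (negbTE xi).
have Fs x : 0 < M F (entry x (shift_col b i' (col d i') x)).
  by rewrite /shift_col; case: eqP => // ->.
have [c' c'V c'E] := facet_transversal Fs.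
have dia : col a i' != col d i'.
  by apply: contraNneq di' => <-; have [_ aE _] := colP ca; rewrite -aE codom_f.
have bia : col b i' = col a i' by rewrite cE /shift_col (negbTE i'i).
exists i', c'; split=> //.
- have [_ bE _] := colP (card_V bV); rewrite -bE; apply/codomP => -[x xd].
  have xi' : x = i' by apply: facet_col_inj (Fd); rewrite xd.
  by rewrite xi' bia in xd; rewrite xd eqxx in dia.
- apply: (opt_sub hle (multidegree_opt (k := k) hle hn degF)).
  apply: entry_lep => x y; rewrite mnmDE mfunE mnm1E eq_entry.
  have [bx|_] := eqVneq (col b x) y.
    rewrite -bx; case: (eqVneq i' x) => [<-|_]; last exact: FB.
    by rewrite bia eq_sym (negbTE dia) addn0 -bia.
  by case: eqP => [<-|] //=; case: eqP => [<-|].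
- rewrite !inE c'V andbT; apply: contraNneq dia => c'a.
  by have := c'E i'; rewrite c'a /shift_col eqxx => ->.
Qed.

(** The exponent that stops being standard is [wt F]. Sets of these sizes cannot cover a row of [F],
    which has one more variable, so some transversal of [F] avoids them. After deleting [a], the
    rows of [F] without the columns of [a] meet every vertex left, by [facet_hit]. *)
Lemma few_standard_free : few_standard V -> few_standard (V :\ a).
Proof.
case=> U sU UP; have zU : wt F \in U.
  apply: UP => B Bw.
  have /fin_all_exists [g gP] : forall i, exists j, 0 < M F (entry i j) /\ j \notin B i.
    move=> i; have /subsetPn[j] : ~~ ([set j | 0 < M F (entry i j)] \subset B i).
      by apply/negP => /subset_leq_card; rewrite card_facet_row leqNgt ltnS Bw.
    by rewrite inE; exists j.
  have [c cV cg] := @facet_transversal g (fun i => (gP i).1).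
  by exists c => // i; rewrite cg; case: (gP i).
exists (rem (wt F) U).
  by rewrite size_rem // sU (cardsD1 a V) free_in.
move=> u uP; have uU : u \in U.
  apply: UP => B /uP [b]; rewrite inE => /andP[_ bV] bB.
  by exists b.
have uz : u != wt F.
  apply: contraPneq uP => -> /(_ (fun i => [set j | 0 < M F (entry i j)] :\ col a i)) [].
    move=> i; rewrite -ltnS -card_facet_row [X in _ < X](cardsD1 (col a i)).
    by rewrite inE facet_free.
  move=> b; rewrite !inE => /andP[ba bV].
  have [i bia Fb] := facet_hit bV ba => /(_ i); rewrite !inE Fb andbT negbK => /eqP bi.
  by have [_ aE _] := colP ca; rewrite bi -aE codom_f in bia.
have : u \in wt F :: rem (wt F) U by rewrite -(perm_mem (perm_to_rem zU)).
by rewrite inE (negbTE uz).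
Qed.

End FreeVertex.

Lemma free_sequence_invariant (s : seq {set 'I_m}) V :
  V \subset nsubsets -> (forall b, b \in s -> #|b| = n) ->
  free_sequence_in (po_le k le) (fun e => en_degree e == 1) (remaining V)
    (map (@vertex n m) s) ->
  linked V -> few_standard V ->
  few_standard (V :\: [set b in s]).
Proof.
elim: s V => [|a s IH] V subV cs /=.
  move=> _ _ fV; suff -> : V :\: [set b in [::]] = V by [].
  by apply/setP => b; rewrite !inE.
case/andP => fa fs lV fV; have ca : #|a| = n by apply: cs; rewrite mem_head.
have aV := free_in ca fa.
have [F [FX aF maxF]] := free_facet fa.
have -> : V :\: [set b in a :: s] = (V :\ a) :\: [set b in s].
  by apply/setP => b; rewrite !inE negb_or; case: (b == a); rewrite ?andbF.
apply: IH.
- exact: subset_trans (subsetDl _ _) subV.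
- by move=> b bs; apply: cs; rewrite inE bs orbT.
(* Removing from the subcomplex of [V] the faces containing [a] gives the subcomplex of [V :\ a]. *)
- congr (is_true (free_sequence_in _ _ _ _)): fs; apply/setP => e.
  rewrite !inE; apply/andP/forallP => [[/forallP eV ae] b|eV].
    apply/implyP; rewrite !inE negb_and negbK => /andP[/orP[/eqP -> //|bV] cb].
    by have := eV b; rewrite !inE bV cb.
  split; last first.
    by have := eV a; rewrite !inE eqxx ca eqxx.
  apply/forallP => b; apply/implyP; rewrite !inE => /andP[bV cb].
  by have := eV b; rewrite !inE (negbTE bV) andbF cb.
- exact: (linked_free subV lV ca fa FX aF maxF).
- exact: (few_standard_free subV lV ca fa FX aF maxF).
Qed.

Lemma few_standard_free_sequence (s : seq {set 'I_m}) :
  (forall b, b \in s -> #|b| = n) ->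
  free_sequence_po k le (map (@vertex n m) s) ->
  few_standard (nsubsets :\: [set b in s]).
Proof.
move=> cs fs; apply: free_sequence_invariant => //.
- suff -> : remaining nsubsets = setT by [].
  by apply/setP => e; rewrite !inE; apply/forallP => b; rewrite !inE andNb.
- exact: linked_nsubsets.
- exact: few_standard_nsubsets.
Qed.

End FreeSequences.

(** * The Alexander dual *)

Lemma facets_dual n m (D : {set {set 'I_m}}) :
  (forall a, a \in facets D -> #|a| = n) ->
  facets (dual_complex n D) = nsubsets n m :\: facets D.
Proof.
move=> cD; apply/setP => a; rewrite in_setD [a \in nsubsets n m]inE [in LHS]inE.
apply/maxsetP/andP => [[]|[aD /eqP ca]].
  rewrite inE => /existsP[b /and3P[/eqP cb bD ab]] amax.
  have -> : a = b.
    apply/esym/amax => //; rewrite inE; apply/existsP; exists b.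
    by apply/and3P; split=> //; apply/eqP.
  by rewrite bD cb.
split; first by rewrite inE; apply/existsP; exists a; rewrite ca aD subxx eqxx.
move=> b; rewrite inE => /existsP[c /and3P[/eqP cc cD' bc]] ab.
apply/eqP; rewrite eq_sym eqEcard ab ca -cc; exact: subset_leq_card.
Qed.

Section Assembly.

Variables (k : fieldType) (n m : nat).
Variable le : rel (monT (entries n m)).
Variable Delta : {set {set 'I_m}}.
Hypothesis cardD : forall a, a \in facets Delta -> #|a| = n.
Variable a0 : {set 'I_m}.
Hypothesis a0D : a0 \in facets Delta.
Variable col : {set 'I_m} -> 'I_n -> 'I_m.
Hypothesis leadE : forall a : {set 'I_m}, #|a| = n ->
  lead_mon le (minor k n a) = mfun (col a).
Hypothesis col_inj : forall a b : {set 'I_m}, #|a| = n -> #|b| = n ->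
  col a =1 col b -> a = b.

Local Notation d := (used_card k le Delta).
Local Notation q := #|facets Delta|.
Local Notation N := #|{: blocks n d}|.

Definition gen_facet (x : 'I_q) : {set 'I_m} := enum_val x.

Lemma card_gen_facet x : #|gen_facet x| = n.
Proof. exact/cardD/enum_valP. Qed.

Lemma used_colsP i c :
  reflect (exists x, col (gen_facet x) i = c) (c \in used_cols k le Delta i).
Proof.
rewrite inE has_map; apply: (iffP hasP) => [[a]|[x <-]].
  rewrite mem_enum => aD /=; rewrite leadE ?cardD // -/(entry i c) mfunE => ac.
  exists (enum_rank_in aD a); rewrite /gen_facet enum_rankK_in //.
  by apply/eqP; move: ac; case: eqP.
exists (gen_facet x); first by rewrite mem_enum enum_valP.
by rewrite /= leadE ?card_gen_facet // -/(entry i _) mfunE eqxx.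
Qed.

Lemma used_index_subproof x i : col (gen_facet x) i \in used_cols k le Delta i.
Proof. by apply/used_colsP; exists x. Qed.

Definition used_index x i : 'I_(d i) :=
  enum_rank_in (used_index_subproof x i) (col (gen_facet x) i).

Definition blk i (j : 'I_(d i)) : 'I_N :=
  enum_rank (Tagged (fun i => 'I_(d i)) j : blocks n d).

Definition rowof (r : 'I_N) : 'I_n := tag (enum_val r).
Definition colof (r : 'I_N) : 'I_m := enum_val (tagged (enum_val r)).
Definition pt x i : 'I_N := blk (used_index x i).

Lemma used_card_gt0 i : 0 < d i.
Proof.
apply/card_gt0P; exists (col a0 i); apply/used_colsP.
by exists (enum_rank_in a0D a0); rewrite /gen_facet enum_rankK_in.
Qed.

Definition base i : 'I_N := blk (Ordinal (used_card_gt0 i)).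

Lemma rowof_blk i (j : 'I_(d i)) : rowof (blk j) = i.
Proof. by rewrite /rowof /blk enum_rankK. Qed.

Lemma colof_blk i (j : 'I_(d i)) : colof (blk j) = enum_val j.
Proof. by rewrite /colof /blk enum_rankK. Qed.

Lemma blkP r : exists i (j : 'I_(d i)), r = blk j.
Proof.
rewrite -(enum_valK r); case: (enum_val r) => i j; by exists i, j.
Qed.

Lemma rowcol_inj r s : rowof r = rowof s -> colof r = colof s -> r = s.
Proof.
have [i [j ->]] := blkP r; have [i' [j' ->]] := blkP s.
rewrite !rowof_blk !colof_blk => ii'; case: i' / ii' j' => j'.
by move/enum_val_inj ->.
Qed.

Lemma blk_inj i : injective (@blk i).
Proof.
move=> j j' /(congr1 colof); rewrite !colof_blk; exact: enum_val_inj.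
Qed.

Lemma baseK : cancel base rowof. Proof. by move=> i; apply: rowof_blk. Qed.

Lemma ptK x : cancel (pt x) rowof. Proof. by move=> i; apply: rowof_blk. Qed.

Lemma colof_pt x i : colof (pt x i) = col (gen_facet x) i.
Proof. by rewrite colof_blk enum_rankK_in // used_index_subproof. Qed.

Lemma pt_inj x y : x != y -> exists i, pt x i != pt y i.
Proof.
move=> xy; apply/existsP; apply: contraNT xy; rewrite negb_exists => /forallP H.
apply/eqP/enum_val_inj/col_inj; try exact: card_gen_facet.
by move=> i; have := H i; rewrite negbK -!colof_pt => /eqP ->.
Qed.

Definition entry_of r := entry (rowof r) (colof r).

Lemma entry_of_inj : injective entry_of.
Proof.
by move=> r s /eqP; rewrite eq_entry => /andP[/eqP rs /eqP cc]; apply: rowcol_inj.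
Qed.

Lemma push_entry_of w r : mnm_push entry_of w (entry_of r) = w r.
Proof.
by rewrite mnm_pushE (big_pred1 r) // => s; rewrite /= (inj_eq entry_of_inj).
Qed.

Definition gen_mon x : 'X_{1..N} := (\sum_i U_(pt x i))%MM.

Lemma gen_monE x r : gen_mon x r = [exists i, pt x i == r].
Proof.
rewrite /gen_mon mnm_sumE; have [/existsP[i /eqP <-]|] := boolP [exists i, pt x i == r].
  rewrite (bigD1 i) //= mnm1E eqxx big1 // => i' ii'.
  rewrite mnm1E; case: eqP => // e; case/eqP: ii'.
  by rewrite -(ptK x i') e ptK.
rewrite negb_exists => /forallP H; rewrite big1 // => i _.
by rewrite mnm1E (negbTE (H i)).
Qed.

Lemma gen_mon_le x (v : 'X_{1..N}) : (forall i, 0 < v (pt x i)) -> (gen_mon x <= v)%MM.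
Proof.
move=> H; apply/mnm_lepP => r; rewrite gen_monE.
by have [/existsP[i /eqP <-]|] := boolP [exists i, pt x i == r].
Qed.

Lemma push_gen_mon x : mnm_push entry_of (gen_mon x) = mfun (col (gen_facet x)).
Proof.
rewrite mnm_push_sum /mfun; apply: eq_bigr => i _.
by rewrite mnm_push1 /entry_of ptK colof_pt.
Qed.

Local Notation rainJ := (fun p => rain le Delta (@used_incl k n m le Delta p)).

Lemma rainJX v : rainJ 'X_[v] <-> exists x, (gen_mon x <= v)%MM.
Proof.
have -> : @used_incl k n m le Delta 'X_[v] = 'X_[mnm_push entry_of v].
  exact: (msubst_push k entry_of v).
split=> [/mon_ideal_X[u /mapP[a]]|[x xv]].
  rewrite mem_enum => aD ->; rewrite leadE ?cardD // => av.
  exists (enum_rank_in aD a); apply: gen_mon_le => i.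
  rewrite -push_entry_of; apply: leq_trans (mnm_lepP av _).
  by rewrite /entry_of ptK colof_pt /gen_facet enum_rankK_in // mfunE eqxx.
apply: (mon_idealX _ (u := mfun (col (gen_facet x)))).
  apply/mapP; exists (gen_facet x); first by rewrite mem_enum enum_valP.
  by rewrite leadE ?card_gen_facet.
by rewrite -push_gen_mon; apply: mnm_push_le.
Qed.

(** All generators have degree n, so none properly divides another. *)
Lemma min_gen_rainJ u : min_gen rainJ u <-> exists x, u = gen_mon x.
Proof.
have dx x : mdeg (gen_mon x) = n.
  rewrite mdeg_sum (eq_bigr (fun=> 1)) ?sum_nat_const ?card_ord ?muln1 // => i _.
  exact: mdeg1.
split=> [[/rainJX [x xu] umin]|[x ->]].
  by exists x; apply/esym/umin => //; apply/rainJX; exists x; apply: lepm_refl.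
split=> [|v /rainJX[y yv] vx]; first by apply/rainJX; exists x; apply: lepm_refl.
apply: lem_mdeg_eq => //; apply: (@leq_trans (mdeg (gen_mon y))).
  by rewrite !dx.
by rewrite -(submK yv) mdegD leq_addl.
Qed.

Lemma rain_dualE : @rain_dual k n m le Delta = hitting_ideal (k := k) pt.
Proof.
apply: functional_extensionality => p; apply: propositional_extensionality.
apply: eq_mon_ideal => v; split=> [H x|H u /min_gen_rainJ [x ->]].
  have [|w [w0 wx wv]] := H (gen_mon x); first by apply/min_gen_rainJ; exists x.
  have [r wr] : exists r, 0 < w r.
    apply/existsP; apply: contraNT w0; rewrite negb_exists => /forallP w0.
    by apply/eqP/mnmP => r; rewrite mnm0E; apply/eqP; rewrite -leqn0 leqNgt.
  have := leq_trans wr (mnm_lepP wx r); rewrite gen_monE lt0b => /existsP[i /eqP xr].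
  by exists i; rewrite xr; apply: leq_trans wr (mnm_lepP wv r).
have [i vi] := H x; exists U_(pt x i)%MM; split.
- by rewrite mnm1_eq0.
- by rewrite lep1mP gen_monE; have -> : [exists i0, pt x i0 == pt x i] by apply/existsP; exists i.
- by rewrite lep1mP -lt0n.
Qed.

Definition diff_vars : seq 'I_N :=
  [seq enum_rank t | t <- enum {: blocks n d} & 0 < nat_of_ord (tagged t)].

Lemma base_first (t : blocks n d) : base (tag t) = enum_rank (first_in_block t).
Proof.
by congr enum_rank; congr (existT _ _ _); apply: val_inj.
Qed.

Lemma var_differencesE : var_differences k d = map (vdiff k rowof base) diff_vars.
Proof.
rewrite /var_differences /diff_vars -map_comp; apply: eq_map => t /=.
by rewrite /vdiff /rowof enum_rankK base_first.
Qed.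

Lemma uniq_diff_vars : uniq diff_vars.
Proof.
by rewrite (map_inj_uniq (@enum_rank_inj _)) filter_uniq ?enum_uniq.
Qed.

Lemma mem_diff_vars r : (r \in diff_vars) = (r != base (rowof r)).
Proof.
rewrite -(enum_valK r) mem_map; last exact: enum_rank_inj.
rewrite mem_filter mem_enum andbT /rowof enum_rankK base_first.
rewrite (inj_eq enum_rank_inj); case: (enum_val r) => i j /=.
rewrite /first_in_block /= -tag_eqE /tag_eq /= eqxx /= tagged_asE.
by rewrite -val_eqE /= lt0n.
Qed.

(** Translates between sets of columns and monomials: a family [B] with at most [u i] columns in row
    [i] becomes a monomial with row degrees [u] whose support contains the used variables of [B]. *)
Lemma few_standard_std : few_standard col (facets Delta) ->
  exists std : 'I_q -> 'X_{1..n}, forall u,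
  (forall w, mnm_push rowof w = u -> ~ hitting pt w) -> exists x, std x = u.
Proof.
case=> U sU UP; exists (fun x => nth 0%MM U x) => u uP.
suff uU : u \in U.
  have iq : index u U < q by rewrite -sU index_mem.
  by exists (Ordinal iq); apply: nth_index.
apply: UP => B Bu.
pose S i := [set r | (rowof r == i) && (colof r \in B i)].
have SB i : #|S i| <= u i.
  apply: leq_trans (Bu i); rewrite -(card_in_imset (f := colof) (D := S i)).
    by apply/subset_leq_card/subsetP => c /imsetP[r]; rewrite inE => /andP[_ rB] ->.
  move=> r s; rewrite !inE => /andP[/eqP ri _] /andP[/eqP si _].
  by apply: rowcol_inj; rewrite ri si.
(* Powers of the base variable pad each row to degree [u i]; a larger support only makes it harder
   to avoid. *)
pose w : 'X_{1..N} := (\sum_i (\sum_(r in S i) U_(r) + U_(base i) *+ (u i - #|S i|)))%MM.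
have wr r : colof r \in B (rowof r) -> 0 < w r.
  move=> rB; rewrite /w mnm_sumE (bigD1 (rowof r)) //= mnmDE mnm_sumE.
  by rewrite (bigD1 r) /= ?inE ?eqxx ?rB // mnm1E eqxx.
have pw : mnm_push rowof w = u.
  rewrite mnm_push_sum [RHS]multinomUE_id; apply: eq_bigr => i _.
  rewrite mnm_pushD mnm_push_sum (eq_bigr (fun=> U_(i)%MM)); last first.
    by move=> r; rewrite inE => /andP[/eqP <- _]; rewrite mnm_push1.
  apply/mnmP => j; rewrite mnmDE mnm_sumE mulmnE sum_nat_const mnm_pushE.
  rewrite (eq_bigr (fun r => (U_(base i) : 'X_{1..N})%MM r * (u i - #|S i|))).
    rewrite -big_distrl -mnm_pushE mnm_push1 baseK -/(U_(i)%MM j) /=.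
    by rewrite mulnC -mulnDr subnKC.
  by move=> r _; rewrite mulmnE.
have [/existsP[x /forallP xw]|] := boolP [exists x, [forall i, w (pt x i) == 0]].
  exists (gen_facet x); first exact: enum_valP.
  move=> i; apply/negP => xB; have := wr (pt x i).
  by rewrite ptK colof_pt xB (eqP (xw i)) => /(_ isT).
rewrite negb_exists => /forallP H; case: (uP w pw) => x.
have := H x; rewrite negb_forall => /existsP[i]; rewrite -lt0n; by exists i.
Qed.

Definition row_mon i : 'X_{1..N} := (\sum_(j < d i) U_(blk j))%MM.

Lemma push_row_mon i : mnm_push rowof (row_mon i) = (U_(i) *+ d i)%MM.
Proof.
rewrite mnm_push_sum (eq_bigr (fun=> U_(i)%MM)) => [|j _].
  by apply/mnmP => i'; rewrite mnm_sumE sum_nat_const card_ord mulmnE mulnC.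
by rewrite mnm_push1 rowof_blk.
Qed.

Lemma row_mon_hitting i : hitting pt (row_mon i).
Proof.
move=> x; exists i; rewrite /row_mon mnm_sumE (bigD1 (used_index x i)) //=.
by rewrite mnm1E eqxx.
Qed.

Lemma row_mon_le i (w : 'X_{1..N}) :
  (forall j : 'I_(d i), 0 < w (blk j)) -> (row_mon i <= w)%MM.
Proof.
move=> H; apply/mnm_lepP => r; rewrite /row_mon mnm_sumE.
have [/existsP[j /eqP <-]|] := boolP [exists j : 'I_(d i), blk j == r].
  rewrite (bigD1 j) //= mnm1E eqxx big1 ?H // => j' jj'.
  by rewrite mnm1E (inj_eq (@blk_inj i)) (negbTE jj').
rewrite negb_exists => /forallP H'; rewrite big1 // => j _.
by rewrite mnm1E (negbTE (H' j)).
Qed.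

(** The Artinian ideal is taken to be the image of the dual ideal under the collapse, which settles
    the clause on images by definition. *)
Definition folded : {mpoly k[n]} -> Prop :=
  fun p => exists2 s, hitting_ideal (k := k) pt s & fold_rows rowof s = p.

Lemma folded_monomial p : folded p <->
  mon_ideal (fun u => exists2 w, hitting pt w & mnm_push rowof w = u) p.
Proof.
split=> [[s [t [ht ->]] <-]|[t [ht ->]]].
  rewrite rmorph_sum big_seq; apply: ideal_sum => [|c /ht [w hw ->]].
    exact: ideal_gen_ideal.
  rewrite rmorphM /= /fold_rows msubst_push.
  have [_ _ JM] := ideal_gen_ideal (fun p : {mpoly k[n]} => exists2 u,
    (exists2 w, hitting pt w & mnm_push rowof w = u) & p = 'X_[u]).
  by apply: JM; apply: ideal_gen_incl; exists (mnm_push rowof w) => //; exists w.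
elim: t ht => [|c t IH] ht.
  rewrite big_nil; exists 0%R; rewrite ?rmorph0 //.
  by case: (ideal_gen_ideal (fun p : {mpoly k[N]} => exists2 u, hitting pt u & p = 'X_[u])).
have [_ [w hw <-] cE] := ht c (mem_head _ _).
have [s Is sE] := IH (fun e et => ht e (mem_behead (s := c :: t) et)).
have [_ ID IM] := ideal_gen_ideal (fun p : {mpoly k[N]} => exists2 u, hitting pt u & p = 'X_[u]).
exists (unfold_rows base c.1 * 'X_[w] + s)%R.
  by apply: ID => //; apply: IM; apply: ideal_gen_incl; exists w.
rewrite rmorphD rmorphM /= sE unfold_rowsK; last exact: baseK.
by rewrite big_cons cE /fold_rows msubst_push.
Qed.

Lemma folded_polarization : few_standard col (facets Delta) ->
  polarization folded (@rain_dual k n m le Delta).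
Proof.
case/few_standard_std => std stdP; rewrite /polarization rain_dualE.
have q0 : 0 < q by apply/card_gt0P; exists a0.
have folded_row i : folded 'X_[U_(i) *+ d i].
  apply/folded_monomial/ideal_gen_incl; exists (U_(i) *+ d i)%MM => //.
  by exists (row_mon i); [apply: row_mon_hitting|apply: push_row_mon].
split; split.
- by exists (fun u => exists2 w, hitting pt w & mnm_push rowof w = u) => p; apply: folded_monomial.
- exact: artinian_powers folded_row.
(* A monomial [w] folding into a power of the variable [i] has support in row [i]. Every variable of
   that row belongs to some point, which [w] can only meet there, so [w] is divisible by the product
   of the whole row. *)
- move=> i; split=> // v /folded_monomial/mon_ideal_X [_ [w hw <-] wv] vi.
  apply: lem_anti => //; apply: lepm_trans (wv); rewrite -push_row_mon.
  apply/mnm_push_le/row_mon_le => j.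
  have /used_colsP [x xj] := enum_valP j.
  have xE : pt x i = blk j.
    by apply: rowcol_inj; rewrite ?ptK ?rowof_blk ?colof_pt ?colof_blk.
  have [i' wi'] := hw x; rewrite -xE; suff -> : i = i' by [].
  have := leq_trans (leq_trans wi' (mnm_push_ge rowof w _)) (mnm_lepP wv _).
  move/leq_trans/(_ (mnm_lepP vi _)).
  by rewrite ptK mulmnE mnm1E; case: eqP.
- exact: ideal_gen_ideal.
- rewrite var_differencesE.
  exact: (hitting_regular k baseK ptK stdP pt_inj uniq_diff_vars mem_diff_vars q0).
- by [].
- move=> p Ip fp; rewrite var_differencesE.
  exact: (hitting_diff_mul baseK ptK stdP pt_inj uniq_diff_vars mem_diff_vars).
Qed.

End Assembly.

Theorem corollary6p5 (k : fieldType) (n m : nat) (hn : 0 < n) (hnm : n <= m)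
    (le : rel (monT (entries n m))) (hle : term_order le)
    (Delta : {set {set 'I_m}}) (hDelta : pure_complex n.-1 Delta)
    (hfree : exists s : seq {set 'I_m},
       perm_eq s (enum (facets (dual_complex n Delta))) /\
       free_sequence_po k le (map (@vertex n m) s)) :
  exists J : {mpoly k[n]} -> Prop, polarization J (@rain_dual k n m le Delta).
Proof.
case: hDelta => sD D0 cD.
have cardD a : a \in facets Delta -> #|a| = n by move/cD; rewrite prednK.
have [a0 a0D] : exists a0, a0 \in facets Delta.
  have /set0Pn [t tD] := D0.
  have [a amax _] := @maxset_exists _ (fun s => s \in Delta) t tD.
  by exists a; rewrite inE.
have [col [colP leadE]] := lead_matchings k hle hnm.
have [s [sP fs]] := hfree.
have sE (b : {set 'I_m}) : (b \in s) = (#|b| == n) && (b \notin facets Delta).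
  by rewrite (perm_mem sP) mem_enum (facets_dual cardD) !inE andbC.
eexists; apply: (folded_polarization cardD a0D leadE _ _).
  by move=> a b; exact: (col_inj colP).
(* The facets of [Delta] are the vertices left once the free sequence is deleted. *)
have -> : facets Delta = nsubsets n m :\: [set b in s].
  apply/setP => b; rewrite !in_setD [b \in nsubsets n m]inE [b \in [set _ in _]]inE sE.
  rewrite negb_and negbK; case: (eqVneq #|b| n) => [_|cb] /=; first by rewrite andbT.
  by apply/negbTE; apply: contra cb => /cardD ->.
apply: (few_standard_free_sequence hle hn hnm colP) fs.
by move=> b; rewrite sE => /andP[/eqP].
Qed.
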